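(* Let $a,b,c,d$ be the explicit $5\times 5$ matrices over $\mathbb{Z}[\tfrac{1}{\sqrt{-2}}]$ given in the context, and let $H=\langle b,c\rangle$, $K=\langle a,b,d\rangle$. Then $a,b,c,d\in \mathrm{SU}(5,\mathbb{Z}[\tfrac{1}{\sqrt{-2}}])$, $H\cong \mathrm{GL}(2,3)$, $K\cong S_4$, and $H\cap K=\langle a,b\rangle$ is dihedral of order $8$. Consequently, with $G=H*_{H\cap K}K$ (an amalgam of the form $\mathrm{GL}(2,3)*_{D_8}S_4$), the inclusions of $H$ and $K$ induce a unitary representation $\rho:G\to \mathrm{SU}(5,\mathbb{Z}[\tfrac{1}{\sqrt{-2}}])$, whose kernel is a free group. Moreover $\rho$ lifts a $5$-dimensional representation of $M_{11}$ in characteristic $3$: for each prime ideal $\pi$ of $\mathbb{Z}[\sqrt{-2}]$ containing $3$, the reduction of $\rho$ modulo $\pi$ is a homomorphism $G\to \mathrm{SL}(5,3)$ that is the composite of a surjective homomorphism $G\to M_{11}$ with a $5$-dimensional absolutely irreducible faithful representation $M_{11}\to \mathrm{SL}(5,3)$ of the Mathieu group $M_{11}$ over $\mathrm{GF}(3)$.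
   Context: Write $\mathbb{Z}[\tfrac{1}{\sqrt{-2}}]=\mathbb{Z}[\sqrt{-2},\tfrac12]\subset\mathbb{C}$. $\mathrm{SU}(5,\mathbb{Z}[\tfrac{1}{\sqrt{-2}}])$ is the group of $5\times5$ matrices $x$ with entries in this ring, determinant $1$, and $x\bar{x}^{T}=I$ (bar denotes complex conjugation). The matrices are $$a=\begin{pmatrix}-1&0&0&0&0\\0&-1&0&0&0\\0&0&1&0&0\\0&0&0&0&-1\\0&0&0&1&0\end{pmatrix},\qquad b=\begin{pmatrix}-1&0&0&0&0\\0&1&0&0&0\\0&0&1&0&0\\0&0&0&1&0\\0&0&0&0&-1\end{pmatrix},$$ $$c=\begin{pmatrix}\frac12&\frac{-1}{2}&\frac{-1}{\sqrt{-2}}&0&0\\ \frac12&\frac{-1}{2}&\frac{1}{\sqrt{-2}}&0&0\\ \frac{1}{\sqrt{-2}}&\frac{1}{\sqrt{-2}}&0&0&0\\0&0&0&\frac{-1-\sqrt{-2}}{2}&\frac{-1}{2}\\0&0&0&\frac12&\frac{-1+\sqrt{-2}}{2}\end{pmatrix},\qquad d=\begin{pmatrix}0&0&0&1&0\\0&\frac{-1}{2}&\frac{-1-\sqrt{-2}}{2}&0&0\\0&\frac{1-\sqrt{-2}}{2}&\frac{-1}{2}&0&0\\0&0&0&0&1\\1&0&0&0&0\end{pmatrix}.$$ $H*_{H\cap K}K$ denotes the free product of $H$ and $K$ with the common subgroup $H\cap K$ amalgamated. For a prime ideal $\pi$ of $\mathbb{Z}[\sqrt{-2}]$ containing an odd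 prime $p$, reduction modulo $\pi$ means applying entrywise the ring homomorphism $\mathbb{Z}[\tfrac{1}{\sqrt{-2}}]\to \mathbb{Z}[\sqrt{-2}]/\pi$ extending the quotient map (defined because $2$, and hence $\sqrt{-2}$, is invertible modulo $\pi$). For $p=3$ the residue field is $\mathrm{GF}(3)$. *)

(* Defs.v *)
From HB Require Import structures.
From mathcomp Require Import all_boot all_order all_algebra.
From mathcomp Require Import all_fingroup all_solvable all_character.
From mathcomp Require Import complex boolp reals.

Set Implicit Arguments.
Unset Strict Implicit.
Unset Printing Implicit Defensive.

Import GRing.Theory Num.Theory.
Local Open Scope ring_scope.
Local Open Scope quotient_scope.

Section IntegerAdjunction.
Variables (C : comNzRingType) (t : C).

Definition in_intAdj : {pred C} :=
  fun z => `[< exists p : {poly int}, z = (map_poly intr p).[t] >].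

Lemma in_intAdjP z :
  reflect (exists p : {poly int}, z = (map_poly intr p).[t]) (z \in in_intAdj).
Proof. exact: asboolP. Qed.

Lemma in_intAdj_subring : subring_closed in_intAdj.
Proof.
split.
- by apply/in_intAdjP; exists 1; rewrite rmorph1 hornerC.
- move=> x y /in_intAdjP[p ->] /in_intAdjP[q ->]; apply/in_intAdjP.
  by exists (p - q); rewrite rmorphB hornerD hornerN.
- move=> x y /in_intAdjP[p ->] /in_intAdjP[q ->]; apply/in_intAdjP.
  by exists (p * q); rewrite rmorphM hornerM.
Qed.

HB.instance Definition _ :=
  GRing.isSubringClosed.Build C in_intAdj in_intAdj_subring.

(* The subring Z[t] of C. *)
Record intAdj := IntAdj { intAdj_val :> C; _ : intAdj_val \in in_intAdj }.

HB.instance Definition _ := [isSub for intAdj_val].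
HB.instance Definition _ := [Choice of intAdj by <:].
HB.instance Definition _ := [SubChoice_isSubComNzRing of intAdj by <:].

End IntegerAdjunction.

Section SpecialUnitary.
Variables (C : numClosedFieldType) (t : C) (n : nat).

Definition toC (x : 'M[intAdj t]_n) : 'M[C]_n := map_mx val x.

Definition in_SU (x : 'M[intAdj t]_n) : bool :=
  (\det x == 1) && (toC x *m (map_mx Num.conj (toC x))^T == 1%:M).

Record SU := MkSU { SU_val :> 'M[intAdj t]_n; _ : in_SU SU_val }.

HB.instance Definition _ := [isSub for SU_val].
HB.instance Definition _ := [Choice of SU by <:].

Lemma toCM x y : toC (x *m y) = toC x *m toC y.
Proof. exact: map_mxM. Qed.

Lemma toC1 : toC 1%:M = 1%:M.
Proof. exact: map_mx1. Qed.

Lemma in_SU1 : in_SU 1%:M.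
Proof. by rewrite /in_SU det1 eqxx toC1 map_mx1 trmx1 mulmx1 eqxx. Qed.

Lemma in_SUM x y : in_SU x -> in_SU y -> in_SU (x *m y).
Proof.
move=> /andP[/eqP dx /eqP ux] /andP[/eqP dy /eqP uy].
rewrite /in_SU det_mulmx dx dy mulr1 eqxx /= toCM map_mxM trmx_mul.
by rewrite mulmxA -(mulmxA (toC x)) uy mulmx1 ux.
Qed.

(* Z[t] carries no unit ring structure, hence \adj rather than invmx. *)
Lemma in_SUV x : in_SU x -> in_SU (\adj x).
Proof.
move=> /andP[/eqP dx /eqP ux].
have xV : x *m \adj x = 1%:M by rewrite mul_mx_adj dx.
have Vx : \adj x *m x = 1%:M by rewrite mul_adj_mx dx.
have xVC : toC x *m toC (\adj x) = 1%:M by rewrite -toCM xV toC1.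
have VxC : toC (\adj x) *m toC x = 1%:M by rewrite -toCM Vx toC1.
have E : toC (\adj x) = (map_mx Num.conj (toC x))^T.
  by rewrite -[RHS]mul1mx -VxC -mulmxA ux mulmx1.
apply/andP; split.
  by apply/eqP; rewrite -[LHS]mul1r -{1}dx -det_mulmx xV det1.
rewrite {2}E map_trmx trmxK -map_mx_comp.
rewrite (_ : map_mx _ (toC x) = toC x) ?VxC //.
by apply/matrixP => i j; rewrite mxE /= conjCK.
Qed.

Definition SU_one : SU := MkSU in_SU1.
Definition SU_mul (x y : SU) : SU := MkSU (in_SUM (valP x) (valP y)).
Definition SU_inv (x : SU) : SU := MkSU (in_SUV (valP x)).

Lemma SU_mulA : associative SU_mul.
Proof. by move=> x y z; apply: val_inj; rewrite /= mulmxA. Qed.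
Lemma SU_mul1 : left_id SU_one SU_mul.
Proof. by move=> x; apply: val_inj; rewrite /= mul1mx. Qed.
Lemma SU_mulr1 : right_id SU_one SU_mul.
Proof. by move=> x; apply: val_inj; rewrite /= mulmx1. Qed.
Lemma SU_mulV : left_inverse SU_one SU_inv SU_mul.
Proof.
move=> x; apply: val_inj; rewrite /= mul_adj_mx.
by case/andP: (valP x) => /eqP ->.
Qed.
Lemma SU_mulrV : right_inverse SU_one SU_inv SU_mul.
Proof.
move=> x; apply: val_inj; rewrite /= mul_mx_adj.
by case/andP: (valP x) => /eqP ->.
Qed.

HB.instance Definition _ :=
  isGroup.Build SU SU_mulA SU_mul1 SU_mulr1 SU_mulV SU_mulrV.

End SpecialUnitary.

(* The group whose elements are those of the subgroup P of X. *)
Section SubgroupType.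
Variables (X : groupType) (P : groupClosed X).

Record subgrp := Subgrp { subgrp_val :> X; _ : subgrp_val \in P }.

HB.instance Definition _ := [isSub for subgrp_val].
HB.instance Definition _ := [Choice of subgrp by <:].

Lemma subgrp_closed : group_closed (P : {pred X}).
Proof. by split; [exact: gpred1 | exact: gpredF]. Qed.

HB.instance Definition _ :=
  SubChoice_isSubGroup.Build X (P : {pred X}) subgrp subgrp_closed.

End SubgroupType.

Section GeneratedSubgroup.
Variables (X : groupType) (S : seq X).

Definition in_gen : {pred X} :=
  fun x => `[< forall P : {pred X},
                 group_closed P -> {subset S <= P} -> x \in P >].

Lemma genP x :
  reflect (forall P : {pred X}, group_closed P -> {subset S <= P} -> x \in P)
          (x \in in_gen).
Proof. exact: asboolP. Qed.

Lemma gen1 : (1 : X)%g \in in_gen.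
Proof. by apply/genP => P []. Qed.
Lemma genM : mulg_closed in_gen.
Proof.
move=> x y /genP Gx /genP Gy; apply/genP => P cP sP.
by apply: group_closedM => //; [apply: Gx | apply: Gy].
Qed.
Lemma genV : invg_closed in_gen.
Proof.
move=> x /genP Gx; apply/genP => P cP sP.
by apply: group_closedV => //; apply: Gx.
Qed.

Definition gen : groupClosed X := HB.pack in_gen
  (isMul1Closed.Build X in_gen gen1)
  (isMulClosed.Build X in_gen genM)
  (isInvClosed.Build X in_gen genV).

End GeneratedSubgroup.

Section SubgroupIntersection.
Variables (X : groupType) (P Q : groupClosed X).

Definition in_cap : {pred X} := fun x => (x \in P) && (x \in Q).

Lemma cap1 : (1 : X)%g \in in_cap.
Proof. by rewrite unfold_in !gpred1. Qed.
Lemma capM : mulg_closed in_cap.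
Proof.
by move=> x y /andP[Px Qx] /andP[Py Qy]; rewrite unfold_in !gpredM.
Qed.
Lemma capV : invg_closed in_cap.
Proof. by move=> x /andP[Px Qx]; rewrite unfold_in !gpredV Px Qx. Qed.

Definition cap : groupClosed X := HB.pack in_cap
  (isMul1Closed.Build X in_cap cap1)
  (isMulClosed.Build X in_cap capM)
  (isInvClosed.Build X in_cap capV).

Definition capl (x : subgrp cap) : subgrp P :=
  Subgrp (proj1 (andP (valP x))).
Definition capr (x : subgrp cap) : subgrp Q :=
  Subgrp (proj2 (andP (valP x))).

End SubgroupIntersection.

Section Kernel.
Variables (G X : groupType) (f : {multiplicative G -> X}).

Definition in_ker_hom : {pred G} := fun x => f x == 1%g.

Lemma mulg_hom1 : f 1%g = 1%g.
Proof. by apply: (mulgI (f 1%g)); rewrite -gmulfM !mulg1. Qed.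

Lemma ker_hom1 : (1 : G)%g \in in_ker_hom.
Proof. by rewrite unfold_in mulg_hom1. Qed.
Lemma ker_homM : mulg_closed in_ker_hom.
Proof.
by move=> x y /eqP fx /eqP fy; rewrite unfold_in gmulfM fx fy mulg1.
Qed.
Lemma ker_homV : invg_closed in_ker_hom.
Proof.
move=> x /eqP fx; rewrite unfold_in.
by rewrite -[f _]mul1g -{1}fx -gmulfM mulgV mulg_hom1.
Qed.

Definition ker_hom : groupClosed G := HB.pack in_ker_hom
  (isMul1Closed.Build G in_ker_hom ker_hom1)
  (isMulClosed.Build G in_ker_hom ker_homM)
  (isInvClosed.Build G in_ker_hom ker_homV).

End Kernel.

Definition hom_onto (G : groupType) (gT : finGroupType)
    (f : {multiplicative G -> gT}) (S : {set gT}) : Prop :=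
  forall s : gT, s \in S <-> exists g : G, f g = s.

Definition iso_fin (G : groupType) (gT : finGroupType) (S : {group gT}) : Prop :=
  exists f : {multiplicative G -> gT}, injective f /\ hom_onto f S.

(* B is a free basis of F: every map from B to a group extends uniquely to a
   homomorphism; the values of f outside B are irrelevant. *)
Definition free_group (F : groupType) : Prop :=
  exists B : F -> Prop, forall (Y : groupType) (f : F -> Y),
    exists h : {multiplicative F -> Y},
      (forall x, B x -> h x = f x) /\
      (forall h' : {multiplicative F -> Y},
         (forall x, B x -> h' x = f x) -> h' =1 h).

(* Words in the letters of H and K, modulo the congruence generated by the
   multiplication tables of H and K and the identification of f l with g l. *)
Section Amalgam.
Variables (L : Type) (H K : groupType) (f : L -> H) (g : L -> K).

Let word := seq (H + K).
(* finset also defines a repr. *)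
Local Notation repr := generic_quotient.repr.

Inductive amalg_eq : word -> word -> Prop :=
| Amalg_refl u : amalg_eq u u
| Amalg_sym u v : amalg_eq u v -> amalg_eq v u
| Amalg_trans u v w : amalg_eq u v -> amalg_eq v w -> amalg_eq u w
| Amalg_cat u u' v v' :
    amalg_eq u u' -> amalg_eq v v' -> amalg_eq (u ++ v) (u' ++ v')
| Amalg_1l : amalg_eq [:: inl 1%g] [::]
| Amalg_1r : amalg_eq [:: inr 1%g] [::]
| Amalg_Ml x y : amalg_eq [:: inl x; inl y] [:: inl (x * y)%g]
| Amalg_Mr x y : amalg_eq [:: inr x; inr y] [:: inr (x * y)%g]
| Amalg_glue l : amalg_eq [:: inl (f l)] [:: inr (g l)].

Definition amalg_rel : rel word := fun u v => `[< amalg_eq u v >].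

Lemma amalg_relP u v : reflect (amalg_eq u v) (amalg_rel u v).
Proof. exact: asboolP. Qed.

Lemma amalg_rel_equiv : equiv_class_of amalg_rel.
Proof.
split=> [u|u v|v u w].
- exact/amalg_relP/Amalg_refl.
- by apply/amalg_relP/amalg_relP; apply: Amalg_sym.
- by move=> /amalg_relP uv /amalg_relP vw; apply/amalg_relP/(Amalg_trans uv).
Qed.

Canonical amalg_equiv := EquivRelPack amalg_rel_equiv.
Canonical amalg_encModRel := defaultEncModRel amalg_rel.

Definition amalg := {eq_quot amalg_rel}.

HB.instance Definition _ : EqQuotient word amalg_rel amalg :=
  EqQuotient.on amalg.
HB.instance Definition _ := Choice.on amalg.

Lemma amalg_piP (u v : word) : (\pi_amalg u = \pi_amalg v) <-> amalg_eq u v.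
Proof.
split=> [/eqmodP/amalg_relP //|uv].
by apply/eqmodP/amalg_relP.
Qed.

Lemma amalg_repr (u : word) : amalg_eq (repr (\pi_amalg u)) u.
Proof. by apply/amalg_piP; rewrite reprK. Qed.

Definition letter_inv (z : H + K) : H + K :=
  match z with inl x => inl x^-1%g | inr y => inr y^-1%g end.
Definition word_inv (u : word) : word := rev (map letter_inv u).

Lemma letter_invK : involutive letter_inv.
Proof. by case=> x /=; rewrite invgK. Qed.

Lemma word_inv_cat u v : word_inv (u ++ v) = word_inv v ++ word_inv u.
Proof. by rewrite /word_inv map_cat rev_cat. Qed.

Lemma word_invK : involutive word_inv.
Proof. by move=> u; rewrite /word_inv map_rev revK mapK //; exact: letter_invK. Qed.

Lemma word_mulV u : amalg_eq (u ++ word_inv u) [::].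
Proof.
elim: u => [|z u IH]; first exact: Amalg_refl.
have zV : amalg_eq ([:: z] ++ [:: letter_inv z]) [::].
  case: z => x /=.
    by apply: Amalg_trans (Amalg_Ml _ _) _; rewrite mulgV; exact: Amalg_1l.
  by apply: Amalg_trans (Amalg_Mr _ _) _; rewrite mulgV; exact: Amalg_1r.
apply: Amalg_trans zV.
rewrite -cat1s word_inv_cat -catA; apply: Amalg_cat (Amalg_refl _) _.
rewrite catA -[X in amalg_eq _ X]cat0s.
exact: Amalg_cat IH (Amalg_refl _).
Qed.

Lemma word_inv_eq u v : amalg_eq u v -> amalg_eq (word_inv u) (word_inv v).
Proof.
move=> uv.
have h1 : amalg_eq (word_inv u ++ (v ++ word_inv v)) (word_inv u).
  rewrite -[X in amalg_eq _ X]cats0.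
  exact: Amalg_cat (Amalg_refl _) (word_mulV v).
apply: Amalg_trans (Amalg_sym h1) _; rewrite catA -[X in amalg_eq _ X]cat0s.
apply: Amalg_cat (Amalg_refl _).
apply: Amalg_trans (Amalg_cat (Amalg_refl _) (Amalg_sym uv)) _.
by rewrite -{2}[u]word_invK; exact: word_mulV.
Qed.

Definition amalg_one : amalg := \pi_amalg [::].
Definition amalg_mul (x y : amalg) : amalg := \pi_amalg (repr x ++ repr y).
Definition amalg_inv (x : amalg) : amalg := \pi_amalg (word_inv (repr x)).

Lemma amalg_mulE u v :
  amalg_mul (\pi_amalg u) (\pi_amalg v) = \pi_amalg (u ++ v).
Proof. by apply/amalg_piP; apply: Amalg_cat; exact: amalg_repr. Qed.

Lemma amalg_invE u : amalg_inv (\pi_amalg u) = \pi_amalg (word_inv u).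
Proof. by apply/amalg_piP/word_inv_eq/amalg_repr. Qed.

Lemma amalg_mulA : associative amalg_mul.
Proof.
elim/quotW=> u; elim/quotW=> v; elim/quotW=> w.
by rewrite (amalg_mulE v w) (amalg_mulE u v) 2!amalg_mulE catA.
Qed.
Lemma amalg_mul1 : left_id amalg_one amalg_mul.
Proof. by move=> x; rewrite -[x]reprK amalg_mulE. Qed.
Lemma amalg_mulr1 : right_id amalg_one amalg_mul.
Proof. by move=> x; rewrite -[x]reprK amalg_mulE cats0. Qed.
Lemma amalg_mulrV : right_inverse amalg_one amalg_inv amalg_mul.
Proof.
move=> x; rewrite -[x]reprK amalg_invE amalg_mulE.
by apply/(amalg_piP _ [::])/word_mulV.
Qed.
Lemma amalg_mulV : left_inverse amalg_one amalg_inv amalg_mul.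
Proof.
move=> x; rewrite -[x]reprK amalg_invE amalg_mulE; apply/(amalg_piP _ [::]).
by rewrite -{2}[repr x]word_invK; exact: word_mulV.
Qed.

HB.instance Definition _ := isGroup.Build amalg
  amalg_mulA amalg_mul1 amalg_mulr1 amalg_mulV amalg_mulrV.

Definition amalg_inl (x : H) : amalg := \pi_amalg [:: inl x].
Definition amalg_inr (y : K) : amalg := \pi_amalg [:: inr y].

Lemma amalg_inlM : {morph amalg_inl : x y / (x * y)%g}.
Proof.
move=> x y; rewrite [RHS]amalg_mulE.
exact/amalg_piP/Amalg_sym/Amalg_Ml.
Qed.
Lemma amalg_inrM : {morph amalg_inr : x y / (x * y)%g}.
Proof.
move=> x y; rewrite [RHS]amalg_mulE.
exact/amalg_piP/Amalg_sym/Amalg_Mr.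
Qed.

HB.instance Definition _ := isMultiplicative.Build H amalg amalg_inl amalg_inlM.
HB.instance Definition _ := isMultiplicative.Build K amalg amalg_inr amalg_inrM.

Lemma amalg_glue l : amalg_inl (f l) = amalg_inr (g l).
Proof. exact/amalg_piP/Amalg_glue. Qed.

Section Lift.
Variables (Y : groupType) (hl : {multiplicative H -> Y}).
Variables (hr : {multiplicative K -> Y}).
Hypothesis hglue : forall l, hl (f l) = hr (g l).

Definition letter_eval (z : H + K) : Y :=
  match z with inl x => hl x | inr y => hr y end.
Definition word_eval (u : word) : Y := (\prod_(z <- u) letter_eval z)%g.

Lemma word_eval_eq u v : amalg_eq u v -> word_eval u = word_eval v.
Proof.
rewrite /word_eval; elim=> {u v} //.
- by move=> u v w _ -> _ ->.
- by move=> u u' v v' _ Eu _ Ev; rewrite !big_cat /= Eu Ev.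
- by rewrite big_seq1 big_nil /= mulg_hom1.
- by rewrite big_seq1 big_nil /= mulg_hom1.
- by move=> x y; rewrite big_cons !big_seq1 /= gmulfM.
- by move=> x y; rewrite big_cons !big_seq1 /= gmulfM.
- by move=> l; rewrite !big_seq1 /= hglue.
Qed.

Definition amalg_lift (x : amalg) : Y := word_eval (repr x).

Lemma amalg_liftE u : amalg_lift (\pi_amalg u) = word_eval u.
Proof. exact/word_eval_eq/amalg_repr. Qed.

Lemma amalg_liftM : {morph amalg_lift : x y / (x * y)%g}.
Proof.
move=> x y; rewrite -[x]reprK -[y]reprK [X in amalg_lift X]amalg_mulE.
by rewrite !amalg_liftE /word_eval big_cat.
Qed.

Lemma amalg_universal :
  exists h : {multiplicative amalg -> Y},
    [/\ h \o amalg_inl =1 hl, h \o amalg_inr =1 hr &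
        forall h' : {multiplicative amalg -> Y},
          h' \o amalg_inl =1 hl -> h' \o amalg_inr =1 hr -> h' =1 h].
Proof.
pose hM := isMultiplicative.Build amalg Y amalg_lift amalg_liftM.
pose h : {multiplicative amalg -> Y} := HB.pack amalg_lift hM.
exists h; split=> [x|y|h' h'l h'r x].
- by rewrite /= amalg_liftE /word_eval big_seq1.
- by rewrite /= amalg_liftE /word_eval big_seq1.
rewrite -[x]reprK /= amalg_liftE /word_eval.
elim: (repr x) => [|z u IH]; first by rewrite big_nil -(mulg_hom1 h').
rewrite big_cons -IH -cat1s -amalg_mulE gmulfM.
by case: z => z; congr (_ * _)%g; [exact: h'l | exact: h'r].
Qed.

End Lift.

End Amalgam.

(* The free product of the subgroups P and Q with their intersection
   amalgamated. *)
Definition amalgam_cap (X : groupType) (P Q : groupClosed X) :=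
  amalg (@capl X P Q) (@capr X P Q).
HB.instance Definition _ (X : groupType) (P Q : groupClosed X) :=
  Group.on (amalgam_cap P Q).

Definition amalgam_l (X : groupType) (P Q : groupClosed X) :
    subgrp P -> amalgam_cap P Q :=
  fun x => amalg_inl (@capl X P Q) (@capr X P Q) x.
Definition amalgam_r (X : groupType) (P Q : groupClosed X) :
    subgrp Q -> amalgam_cap P Q :=
  fun y => amalg_inr (@capl X P Q) (@capr X P Q) y.

Arguments amalgam_l {X P Q} x.
Arguments amalgam_r {X P Q} y.

(* The cycle (x s_1 ... s_k). *)
Definition cyc11 (x : nat) (s : seq nat) : 'S_11 :=
  (\prod_(y <- s) tperm (inord x) (inord y))%g.

(* On the points 0, ..., 10, the group generated by x |-> x + 1 mod 11 and
   (2 6 10 7)(3 9 4 5). *)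
Definition M11 : {group 'S_11} :=
  <<[set cyc11 0 (iota 1 10);
         (cyc11 2 [:: 6; 10; 7]%N * cyc11 3 [:: 9; 4; 5]%N)%g]>>%G.

Section Matrices.
Variable R : realType.
Local Notation C := R[i].

Definition sqrtm2 : C := Complex 0 (Num.sqrt 2).

Definition Zsqrtm2 := intAdj sqrtm2.
HB.instance Definition _ := GRing.ComNzRing.on Zsqrtm2.
Definition Zsqrtm2V := intAdj sqrtm2^-1.
HB.instance Definition _ := GRing.ComNzRing.on Zsqrtm2V.

Definition SU5 := SU sqrtm2^-1 5.
HB.instance Definition _ := Group.on SU5.

Definition mx_of_rows (s : seq (seq C)) : 'M[C]_5 :=
  \matrix_(i, j) nth 0 (nth [::] s i) j.

Local Notation s := sqrtm2.

Definition mxa : 'M[C]_5 := mx_of_rows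
  [:: [:: -1;  0; 0; 0;  0];
      [::  0; -1; 0; 0;  0];
      [::  0;  0; 1; 0;  0];
      [::  0;  0; 0; 0; -1];
      [::  0;  0; 0; 1;  0]].

Definition mxb : 'M[C]_5 := mx_of_rows
  [:: [:: -1; 0; 0; 0;  0];
      [::  0; 1; 0; 0;  0];
      [::  0; 0; 1; 0;  0];
      [::  0; 0; 0; 1;  0];
      [::  0; 0; 0; 0; -1]].

Definition mxc : 'M[C]_5 := mx_of_rows
  [:: [:: 1 / 2; -1 / 2; -1 / s;            0;            0];
      [:: 1 / 2; -1 / 2;  1 / s;            0;            0];
      [:: 1 / s;  1 / s;      0;            0;            0];
      [::     0;      0;      0; (-1 - s) / 2;       -1 / 2];
      [::     0;      0;      0;        1 / 2; (-1 + s) / 2]].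

Definition mxd : 'M[C]_5 := mx_of_rows
  [:: [:: 0;           0;            0; 1; 0];
      [:: 0;      -1 / 2; (-1 - s) / 2; 0; 0];
      [:: 0; (1 - s) / 2;       -1 / 2; 0; 0];
      [:: 0;           0;            0; 0; 1];
      [:: 1;           0;            0; 0; 0]].

(* Zsqrtm2 and Zsqrtm2V are distinct subtypes of C, so q extends the quotient
   map when it agrees with it on elements with the same value in C. *)
Definition extends_quotient (I : prime_idealr Zsqrtm2)
    (q : {rmorphism Zsqrtm2V -> {ideal_quot I}}) : Prop :=
  forall (x : Zsqrtm2) (y : Zsqrtm2V),
    val x = val y -> q y = \pi_{ideal_quot I} x.

End Matrices.

(* Main.v *)
Require Import Defs.
From HB Require Import structures.
From mathcomp Require Import all_boot all_order all_algebra.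
From mathcomp Require Import all_fingroup all_solvable all_character.
From mathcomp Require Import complex boolp reals.
From mathcomp Require classical_sets.
From mathcomp Require Import ring.

Set Implicit Arguments.
Unset Strict Implicit.
Unset Printing Implicit Defensive.

Import GRing.Theory Num.Theory.
Local Open Scope ring_scope.

(* The subgroups H, K and <a, b> are finite, so they are enumerated as lists of
   matrices over Z[1/sqrt(-2)] and identified with GL(2, 3), S_4 and D_8 by
   their actions on a two-dimensional block modulo 3 and on four lines.

   For the kernel N of rho, let N act freely on the Bass-Serre tree of the
   amalgam.  Its vertices modulo N are cosets in the target X of the factors,
   and geodesics to a base vertex yield sections of both kinds of cosets that
   are equivariant under the respective factor.  Their quotient labels every
   edge x with an element of N, trivial on tree edges, and the nontrivial labels
   are a free basis: a map on them is a function w on edges, and the rule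
   c(x, h) = 1, c(x, k) = w(x)^-1 w(x k) defines a cocycle on the amalgam whose
   restriction to N at the base point is the required homomorphism.

   Modulo a prime above 3 the inverse t of sqrt(-2) becomes 1 or -1.  For t = 1
   the reductions of a, b, c, d permute eleven lines of F_3^5, inducing words in
   the two generators of M11; a matrix of determinant 1 is determined by this
   permutation.  As t and -t are conjugate and the matrices are unitary, the
   case t = -1 is dual to it. *)

(** * Subgroups of an amalgam that meet the factors trivially *)

Section FreeKernel.
Local Open Scope group_scope.
Variables (L : Type) (H K X : groupType) (f : L -> H) (g : L -> K).
Local Notation G := (amalg f g).
Local Notation inL := (@amalg_inl L H K f g).
Local Notation inR := (@amalg_inr L H K f g).

(** [true] stands for K and [false] for H; the same Boolean gives the type of a vertex of the
    tree. *)
Definition in_factor (s : bool) (z : G) : Prop :=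
  if s then exists y, z = inR y else exists x, z = inL x.

Lemma in_factor1 s : in_factor s 1.
Proof. by case: s; exists 1; rewrite mulg_hom1. Qed.

Lemma in_factorM s z z' :
  in_factor s z -> in_factor s z' -> in_factor s (z * z').
Proof. by case: s => -[x ->] [y ->]; exists (x * y); rewrite gmulfM. Qed.

Lemma mulg_homV (G1 G2 : groupType) (h : {multiplicative G1 -> G2}) x :
  h x^-1 = (h x)^-1.
Proof. by apply: (mulgI (h x)); rewrite -gmulfM !mulgV mulg_hom1. Qed.

Lemma in_factorV s z : in_factor s z -> in_factor s z^-1.
Proof. by case: s => -[x ->]; exists x^-1; rewrite mulg_homV. Qed.

(** Words are peeled from the right, since the cosets used below change under right
    multiplication. *)
Lemma amalg_ind (P : G -> Prop) :
  P 1 -> (forall x s z, P x -> in_factor s z -> P (x * z)) -> forall x, P x.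
Proof.
move=> P1 PM x; rewrite -[x]generic_quotient.reprK.
elim/last_ind: (generic_quotient.repr x) => [//|u z IH].
rewrite -cats1 -amalg_mulE; case: z => z.
  by apply: (PM _ false) => //; exists z.
by apply: (PM _ true) => //; exists z.
Qed.

Section Kernel.
Variable rho : {multiplicative G -> X}.
Hypothesis rho_inj_l : injective (rho \o inL).
Hypothesis rho_inj_r : injective (rho \o inR).

Lemma in_factor_inj s z z' :
  in_factor s z -> in_factor s z' -> rho z = rho z' -> z = z'.
Proof.
case: s => -[x ->] [y ->].
  by move=> /rho_inj_r ->.
by move=> /rho_inj_l ->.
Qed.

(* The vertices of the quotient of the Bass-Serre tree by the kernel of [rho]
   are the cosets [x * rho (factor s)]; [walk n s x] says that this vertex is
   joined to the base vertex [1 * rho (factor false)] by a walk of length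
   [n]. *)
Fixpoint walk n s x : Prop :=
  if n is m.+1 then exists z, in_factor s z /\ walk m (~~ s) (x * rho z)
  else ~~ s /\ exists z, in_factor false z /\ x = rho z.

Lemma walk_coset n s x z : in_factor s z -> walk n s x -> walk n s (x * rho z).
Proof.
case: n => [|n] /= sz; last first.
  case=> t [st wt]; exists (z^-1 * t); split.
    exact: in_factorM (in_factorV sz) st.
  by rewrite -mulgA -gmulfM mulKVg.
case=> /negbTE s0 [t [st ->]]; rewrite s0 in sz *; split=> //.
by exists (t * z); rewrite gmulfM; split=> //; exact: (@in_factorM false).
Qed.

(** The graph is connected: a letter of type [t] does not move the vertex of type [t], and the
    vertex of the other type is its neighbour. *)
Lemma walk_exists x s : exists n, walk n s (rho x).
Proof.
elim/amalg_ind: x s => [|x t z IH tz] s.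
  case: s.
    exists 1%N, 1; split; first exact: in_factor1.
    by split=> //; exists 1; split; [exact: in_factor1|rewrite mulg_hom1 mulg1].
  by exists 0%N; split=> //; exists 1; split=> //; exact: in_factor1.
have [n wn] := IH t; have {}wn : walk n t (rho (x * z)).
  by rewrite gmulfM; exact: walk_coset.
case: (eqVneq s t) => [->|st]; first by exists n.
exists n.+1, 1; split; first exact: in_factor1.
rewrite mulg_hom1 mulg1; suff -> : ~~ s = t by [].
by case: s t st {IH tz wn} => -[].
Qed.

Definition reached x : Prop := exists y, rho y = x.

Lemma reachedM x z : reached x -> reached (x * rho z).
Proof. by case=> y <-; exists (y * z); rewrite gmulfM. Qed.

(** The distance to the base vertex, set to 0 where no walk exists. *)
Definition vdist s x : nat :=
  classical_sets.xget 0%N (fun n => walk n s x /\ forall m, walk m s x -> (n <= m)%N).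

Lemma vdistP s x : reached x ->
  walk (vdist s x) s x /\ forall n, walk n s x -> (vdist s x <= n)%N.
Proof.
case=> y <-.
suff: exists n, walk n s (rho y) /\
    forall m, walk m s (rho y) -> (n <= m)%N by move=> /(@classical_sets.xgetPex _ 0%N).
have e : exists n, `[< walk n s (rho y) >].
  by have [n wn] := walk_exists y s; exists n; apply/asboolP.
case: (ex_minnP e) => m /asboolP wm min_m; exists m; split=> // n wn.
by apply: min_m; apply/asboolP.
Qed.

Lemma walk_cosetE n s x z :
  in_factor s z -> walk n s (x * rho z) <-> walk n s x.
Proof.
move=> sz; split; last exact: walk_coset.
by move/(walk_coset (in_factorV sz)); rewrite -mulgA -gmulfM mulgV mulg_hom1 mulg1.
Qed.

Lemma vdist_coset s x z : in_factor s z -> vdist s (x * rho z) = vdist s x.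
Proof.
move=> sz; rewrite /vdist; congr classical_sets.xget; apply/funext => n; apply/propext.
by split=> -[wn min_n]; split=> [|m wm]; first [exact/(walk_cosetE _ _ sz)
  | by apply: min_n; exact/(walk_cosetE _ _ sz)].
Qed.

(** As a representative of the coset of [x], [y] names an edge at this vertex; at positive distance
    its other end is one step closer to the base. *)
Definition parent_spec s x y : Prop :=
  exists z, [/\ in_factor s z, y = x * rho z & walk (vdist s x).-1 (~~ s) y].

Definition parent s x : X := classical_sets.xget 1 (fun y => parent_spec s x y).

Lemma parentP s x n : reached x -> vdist s x = n.+1 ->
  [/\ exists2 z, in_factor s z & parent s x = x * rho z,
      reached (parent s x) & vdist (~~ s) (parent s x) = n].
Proof.
move=> rx dx; have [wx min_x] := vdistP s rx.
have [z [sz yE wy]] : parent_spec s x (parent s x).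
  apply: (@classical_sets.xgetPex _ 1 (fun y => parent_spec s x y)).
  move: wx; rewrite dx /= => -[z [sz wz]].
  by exists (x * rho z); exists z; split=> //; rewrite dx.
have ry : reached (parent s x) by rewrite yE; exact: reachedM.
split=> //; first by exists z.
have [wy' min_y] := vdistP (~~ s) ry.
apply/eqP; rewrite eqn_leq min_y /=; last by rewrite -[n]/(n.+1.-1) -dx.
(* A shorter walk from the parent, prefixed by this edge, would beat the minimal length for [x]. *)
have := min_x (vdist (~~ s) (parent s x)).+1; rewrite dx ltnS; apply.
by exists z; split=> //; rewrite -yE.
Qed.

(** The specifications of the two parents have the same solutions, so the choice operator returns
    the same value. The equivariance of [section] rests on this. *)
Lemma parent_coset s x z : in_factor s z ->
  parent s (x * rho z) = parent s x.
Proof.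
move=> sz; rewrite /parent; congr (classical_sets.xget _ _).
apply/funext => y; apply/propext; split=> -[t [st -> wt]].
  exists (z * t); split; first exact: in_factorM.
    by rewrite gmulfM mulgA.
  by rewrite vdist_coset in wt.
exists (z^-1 * t); split; first exact: in_factorM (in_factorV sz) st.
  by rewrite gmulfM mulg_homV -mulgA mulKVg.
by rewrite vdist_coset.
Qed.

Definition factor_lift s x y : G :=
  classical_sets.xget 1 (fun z => in_factor s z /\ x * rho z = y).

Lemma factor_liftE s x z : in_factor s z -> factor_lift s x (x * rho z) = z.
Proof.
move=> sz; rewrite /factor_lift.
have := @classical_sets.xgetPex _ 1 (fun t => in_factor s t /\ x * rho t = x * rho z).
case; first by exists z.
by move=> st /mulgI /(in_factor_inj st sz).
Qed.

(* [section s x] is the label in G read along a geodesic from the base vertex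
   to the vertex [(s, x)]. *)
Fixpoint section_rec n s x : G :=
  if n is m.+1 then
    section_rec m (~~ s) (parent s x) * factor_lift s (parent s x) x
  else factor_lift false 1 x.

Definition section s x := section_rec (vdist s x) s x.

Lemma section_root s x : reached x -> vdist s x = 0%N ->
  s = false /\ in_factor false (section s x) /\ rho (section s x) = x.
Proof.
move=> rx d0; have [wx _] := vdistP s rx.
rewrite d0 /= in wx; case: wx => /negbTE s0 [z [sz xE]].
rewrite /section d0 s0 /= xE -[X in factor_lift _ _ X]mul1g.
by rewrite factor_liftE.
Qed.

Lemma section_parent s x n : reached x -> vdist s x = n.+1 ->
  exists2 z, in_factor s z /\ x = parent s x * rho z &
    section s x = section (~~ s) (parent s x) * z.
Proof.
move=> rx dx; have [[z sz yE] ry dy] := parentP rx dx.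
exists z^-1.
  by split; [exact: in_factorV|rewrite yE mulg_homV mulgK].
rewrite /section dx /= dy; congr (_ * _).
rewrite -[X in factor_lift _ _ X](mulgK (rho z)) -yE -mulg_homV.
by rewrite factor_liftE //; exact: in_factorV.
Qed.

Lemma sectionK s x : reached x -> rho (section s x) = x.
Proof.
have [n dx] : exists n, vdist s x = n by exists (vdist s x).
elim: n s x dx => [|n IH] s x dx rx; first by have [_ []] := section_root rx dx.
have [z [sz xE] ->] := section_parent rx dx; have [_ ry dy] := parentP rx dx.
by rewrite gmulfM IH.
Qed.

(** Representatives of a coset share their parent, hence the section up to it; only the last lift
    absorbs [z]. *)
Lemma section_coset s x z : reached x -> in_factor s z ->
  section s (x * rho z) = section s x * z.
Proof.
move=> rx sz; rewrite /section vdist_coset //.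
case dx: (vdist s x) => [|n] /=.
  have [s0 [sx xE]] := section_root rx dx; rewrite s0 in sz sx xE dx *.
  rewrite /section dx /= in sx xE; rewrite -{1}xE -gmulfM.
  rewrite -[rho (_ * z)]mul1g factor_liftE //; exact: in_factorM.
rewrite parent_coset // -mulgA; congr (_ * _).
have [[t st] + _ _] := parentP rx dx; move: (parent s x) => y yE.
have -> : x = y * rho t^-1 by rewrite yE mulg_homV mulgK.
rewrite -mulgA -gmulfM !factor_liftE //; last exact: in_factorV.
exact: in_factorM (in_factorV st) sz.
Qed.

(** The loop that runs along the tree to the K-end of the edge [x], crosses it, and returns from its
    H-end. *)
Definition edge x : G := section true x * (section false x)^-1.

Lemma edge_ker x : reached x -> edge x \in ker_hom rho.
Proof.
by move=> rx; rewrite unfold_in gmulfM mulg_homV !sectionK // mulgV.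
Qed.

Definition edge_k x : subgrp (ker_hom rho) := insubd 1 (edge x).

Lemma val_edge_k x : reached x -> val (edge_k x) = edge x.
Proof. by move=> rx; rewrite val_insubd edge_ker. Qed.

Lemma reached_glue x l : reached (x * rho (inL (f l))) <-> reached x.
Proof.
split; last exact: reachedM.
by move/(reachedM (inL (f l))^-1); rewrite mulg_homV mulgK.
Qed.

(** An amalgamated element lies in both factors, so it multiplies both sections and cancels. *)
Lemma edge_glue x l : reached x -> edge (x * rho (inL (f l))) = edge x.
Proof.
move=> rx; have sl : in_factor false (inL (f l)) by exists (f l).
have sr : in_factor true (inL (f l)) by exists (g l); exact: amalg_glue.
by rewrite /edge !section_coset // invgM mulgA mulgK.
Qed.

(** The edges towards parents form the spanning tree: both sections at such an edge give the section
    at [x] after multiplication by the same [z]. *)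
Lemma edge_parent s x n : reached x -> vdist s x = n.+1 ->
  edge (parent s x) = 1.
Proof.
move=> rx dx; have [_ ry _] := parentP rx dx.
have [z [sz xE] sE] := section_parent rx dx.
suff E : section s (parent s x) = section (~~ s) (parent s x).
  by rewrite /edge; case: s E {sz xE sE dx ry} => /= ->; rewrite mulgV.
apply: (mulIg z); rewrite -sE -section_coset //; congr section.
by rewrite -xE.
Qed.

(** * Cocycles defined by functions on edges *)

Section Cocycle.
Variables (Y : groupType) (w : X -> Y).
Hypothesis w_glue : forall x l, w (x * rho (inL (f l))) = w x.

Definition letter_hom (z : H + K) : G :=
  match z with inl x => inL x | inr y => inR y end.

(** Positions are read at H-ends. A letter of H stays there; a letter k of K crosses [x] to its
    K-end, contributing w(x)^-1, and comes back across x k, contributing w(x k). *)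
Definition letter_cocycle x (z : H + K) : Y :=
  if z is inr y then (w x)^-1 * w (x * rho (inR y)) else 1.

Fixpoint word_cocycle x (u : seq (H + K)) : Y :=
  if u is z :: v then letter_cocycle x z * word_cocycle (x * rho (letter_hom z)) v
  else 1.

Lemma pi_cons z (u : seq (H + K)) :
  (\pi_G (z :: u) = letter_hom z * \pi_G u)%qT.
Proof. by rewrite -cat1s -[LHS]amalg_mulE; case: z. Qed.

Lemma word_cocycle_cat x u v : word_cocycle x (u ++ v) =
  word_cocycle x u * word_cocycle (x * rho (\pi_G u)%qT) v.
Proof.
elim: u x => [|z u IH] x /=.
  by rewrite mul1g (mulg_hom1 rho) mulg1.
by rewrite IH pi_cons gmulfM !mulgA.
Qed.

(** Products in K telescope, and an amalgamated element contributes 1 also as a letter of K, by the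
    invariance of [w]. *)
Lemma word_cocycle_eq u v : amalg_eq f g u v ->
  forall x, word_cocycle x u = word_cocycle x v.
Proof.
elim=> {u v} //=.
- by move=> u v w' _ E1 _ E2 x; rewrite E1.
- move=> u u' v v' uu' Eu _ Ev x; rewrite !word_cocycle_cat Eu Ev.
  by rewrite (iffRL (amalg_piP f g u u') uu').
- by move=> x; rewrite mulg1.
- by move=> x; rewrite !mulg_hom1 !mulg1 mulVg.
- by move=> x y x0; rewrite !mulg1.
- by move=> x y x0; rewrite gmulfM gmulfM !mulg1 !mulgA mulgK.
- by move=> l x; rewrite -amalg_glue w_glue mulVg.
Qed.

Definition cocycle x z : Y := word_cocycle x (@generic_quotient.repr _ G z).

Lemma cocycle_pi x u : cocycle x (\pi_G u)%qT = word_cocycle x u.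
Proof. exact/word_cocycle_eq/amalg_repr. Qed.

Lemma cocycleM x y z : cocycle x (y * z) = cocycle x y * cocycle (x * rho y) z.
Proof.
rewrite -[y]generic_quotient.reprK -[z]generic_quotient.reprK.
by rewrite [X in cocycle _ X]amalg_mulE !cocycle_pi word_cocycle_cat.
Qed.

Lemma cocycle_factor x s z : in_factor s z ->
  cocycle x z = if s then (w x)^-1 * w (x * rho z) else 1.
Proof. by case: s => -[y ->]; rewrite cocycle_pi /= mulg1. Qed.

Hypothesis w_tree : forall x, edge x = 1 -> w x = 1.

(** Parent edges lie in the tree, where [w] is 1, so only the last step to [x] can contribute. *)
Lemma cocycle_section s x : reached x ->
  cocycle 1 (section s x) = if s then w x else 1.
Proof.
have [n dx] : exists n, vdist s x = n by exists (vdist s x).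
elim: n s x dx => [|n IH] s x dx rx.
  by have [-> [sx _]] := section_root rx dx; rewrite (cocycle_factor _ sx).
have [z [sz xE] ->] := section_parent rx dx; have [_ ry dy] := parentP rx dx.
rewrite cocycleM IH // mul1g sectionK // (cocycle_factor _ sz) -xE.
have wy := w_tree (edge_parent rx dx).
by case: s {sz xE dx dy ry} wy => /= ->; rewrite ?invg1 !mul1g.
Qed.

(** As [edge x] does not move the base point, the cocycle identity for [edge x * section false x =
    section true x] isolates its value. *)
Lemma cocycle_edge x : reached x -> cocycle 1 (edge x) = w x.
Proof.
move=> rx; have rE : rho (edge x) = 1 by apply/eqP; exact: edge_ker.
have := cocycleM 1 (edge x) (section false x).
rewrite rE mul1g !cocycle_section // mulg1 => <-.
by rewrite -[RHS](cocycle_section true) // /edge -mulgA mulVg mulg1.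
Qed.
End Cocycle.

Lemma section_1 : section false 1 = 1.
Proof.
have r1 : reached 1 by exists 1; exact: mulg_hom1.
have [_ /(_ 0%N) d0] := vdistP false r1.
have {d0} : vdist false 1 = 0%N.
  apply/eqP; rewrite -leqn0 d0 //; split=> //; exists 1.
  by split; [exact: in_factor1|rewrite mulg_hom1].
move/(section_root r1) => [_ [s1 E]].
by apply: (in_factor_inj s1 (in_factor1 _)); rewrite E mulg_hom1.
Qed.

Definition edge_basis (x : subgrp (ker_hom rho)) : Prop :=
  exists y, [/\ reached y, edge y <> 1 & x = edge_k y].

Lemma edge_extend (Y : groupType) (F : subgrp (ker_hom rho) -> Y) :
  exists h : {multiplicative subgrp (ker_hom rho) -> Y},
    forall x, edge_basis x -> h x = F x.
Proof.
(* Since [w] depends on the edge only through its label, edges with equal labels receive equal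
   values. *)
pose w x := if `[< reached x /\ edge x <> 1 >] then F (edge_k x) else 1.
have w_glue x l : w (x * rho (inL (f l))) = w x.
  rewrite /w /edge_k; case: (pselect (reached x)) => rx.
    by rewrite edge_glue //; do 2?case: asboolP => //; rewrite reached_glue.
  by do 2?case: asboolP => //; rewrite ?reached_glue; tauto.
have w_tree x : edge x = 1 -> w x = 1.
  by move=> e1; rewrite /w; case: asboolP => // -[].
pose h (x : subgrp (ker_hom rho)) : Y := cocycle w 1 (val x).
(* Kernel elements fix the base point, so the cocycle identity becomes multiplicativity. *)
have hM : {morph h : x y / x * y}.
  move=> x y; rewrite /h gmulfM cocycleM // mul1g.
  by have /eqP -> := valP x.
pose hh : {multiplicative subgrp (ker_hom rho) -> Y} :=
  HB.pack h (isMultiplicative.Build _ _ h hM).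
exists hh => x [y [ry ey ->]].
rewrite /= /h val_edge_k // cocycle_edge // /w.
by case: asboolP => // -[].
Qed.

(** The edge labels generate the kernel, by a Schreier-type rewriting. *)
Lemma edge_unique (Y : groupType)
    (h1 h2 : {multiplicative subgrp (ker_hom rho) -> Y}) :
  (forall x, edge_basis x -> h1 x = h2 x) -> h1 =1 h2.
Proof.
move=> hE.
pose E z := exists2 n, val n = z & h1 n = h2 n.
have EM z z' : E z -> E z' -> E (z * z').
  case=> [n <- n12] [n' <- n12']; exists (n * n'); rewrite ?gmulfM //.
  by rewrite n12 n12'.
have EV z : E z -> E z^-1.
  case=> [n <- n12]; exists n^-1; first by [].
  by rewrite !mulg_homV n12.
have E1 : E 1 by exists 1; rewrite ?mulg_hom1.
have Ee x : reached x -> E (edge x).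
  move=> rx; case: (eqVneq (edge x) 1) => [-> //|/eqP ex].
  exists (edge_k x); first exact: val_edge_k.
  by apply: hE; exists x.
(* Appending a letter of H leaves this element unchanged; a letter of K multiplies it by the inverse
   label of the old edge and the label of the new one. For [z] in the kernel it is [z] itself. *)
have ES z : E (z * (section false (rho z))^-1).
  elim/amalg_ind: z => [|z s t Ez st].
    by rewrite mulg_hom1 section_1 invg1 mulg1.
  have rz : reached (rho z) by exists z.
  rewrite gmulfM; case: s st => st; last first.
    by rewrite section_coset // invgM mulgA mulgK.
  have rzt : reached (rho z * rho t) by exact: reachedM.
  have := EM _ _ (EM _ _ Ez (EV _ (Ee _ rz))) (Ee _ rzt).
  rewrite /edge (section_coset rz st) invgM invgK.
  by rewrite !mulgA !mulgKV.
move=> x; have := ES (val x); have /eqP -> := valP x.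
by rewrite section_1 invg1 mulg1 => -[n /val_inj ->].
Qed.

Theorem ker_amalg_free : free_group (subgrp (ker_hom rho)).
Proof.
exists edge_basis => Y F; have [h hF] := edge_extend F.
exists h; split=> // h' h'F; apply: edge_unique => x Bx.
by rewrite h'F // hF.
Qed.

End Kernel.
End FreeKernel.

(** * Reduction modulo a prime above 3 *)

Section IntegerEvaluation.

Definition ieval (A : comNzRingType) (u : A) (p : {poly int}) : A :=
  (map_poly intr p).[u].

Lemma ievalB (A : comNzRingType) (u : A) p q :
  ieval u (p - q) = ieval u p - ieval u q.
Proof. by rewrite /ieval rmorphB hornerD hornerN. Qed.

Lemma ievalM (A : comNzRingType) (u : A) p q :
  ieval u (p * q) = ieval u p * ieval u q.
Proof. by rewrite /ieval rmorphM hornerM. Qed.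

Lemma ieval1 (A : comNzRingType) (u : A) : ieval u 1 = 1.
Proof. by rewrite /ieval rmorph1 hornerC. Qed.

Lemma ieval_CX (A : comNzRingType) (u : A) (m : int) :
  ieval u (m%:P * 'X) = m%:~R * u.
Proof.
by rewrite /ieval rmorphM /= map_polyC map_polyX hornerM hornerX hornerC.
Qed.

Lemma ieval_morph (A B : comNzRingType) (h : {rmorphism A -> B}) u p :
  h (ieval u p) = ieval (h u) p.
Proof.
rewrite /ieval -horner_map -map_poly_comp; congr (_.[_]).
by apply: eq_map_poly => m /=; rewrite rmorph_int.
Qed.

Lemma ieval_comp (A : comNzRingType) (u : A) p q :
  ieval u (p \Po q) = ieval (ieval u q) p.
Proof. by rewrite /ieval map_comp_poly horner_comp. Qed.

(* Up to a power of 2, p is congruent to m + n X modulo 2 X^2 + 1. *)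
Lemma ieval_reduce (p : {poly int}) : exists k (m n : int),
  forall (A : comNzRingType) (u : A), 2 * u ^+ 2 = -1 ->
  2 ^+ k * ieval u p = m%:~R + n%:~R * u.
Proof.
elim/poly_ind: p => [|p c [k [m [n IH]]]].
  by exists 0%N, 0, 0 => A u _; rewrite /ieval rmorph0 horner0 mulr0 mul0r addr0.
exists k.+1, (2 ^+ k.+1 * c - n), (2 * m) => A u u2.
rewrite /ieval rmorphD rmorphM /= map_polyX map_polyC /= hornerD hornerMX hornerC.
rewrite mulrDr mulrA exprS -(mulrA 2) [2 ^+ k * _](IH _ _ u2).
rewrite rmorphB rmorphM rmorphXn /= intrM exprS.
have -> : 2 * (m%:~R + n%:~R * u) * u = 2 * m%:~R * u + n%:~R * (2 * u ^+ 2).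
  by ring.
by rewrite u2; ring.
Qed.

End IntegerEvaluation.

Lemma intr_F3_eq0 (m : int) : (m%:~R == 0 :> 'F_3) = (3 %| m)%Z.
Proof.
have natE n : (n%:R == 0 :> 'F_3) = (3 %| n)%N.
  by rewrite -(dvdn_pcharf (pchar_Fp (isT : prime 3))).
by case: m => n; rewrite dvdzE ?NegzE -?natE ?rmorphN ?oppr_eq0 ?abszN.
Qed.

(** An integer prime to 3 that vanishes in [Q] would give 1 = 0 by Bezout, so an element determines
    its integer representatives modulo 3. *)
Lemma prime_ring_F3 (Q : comNzRingType) : 3%:R = 0 :> Q ->
  (forall x : Q, exists m : int, x = m%:~R) ->
  exists k : {rmorphism Q -> 'F_3}, bijective k.
Proof.
move=> Q3 Qint.
have Q0 (m : int) : (m%:~R == 0 :> Q) = (m%:~R == 0 :> 'F_3).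
  rewrite intr_F3_eq0; apply/eqP/idP => [m0|/dvdzP[n ->]]; last first.
    by rewrite intrM -[3%:~R]/(3%:R : Q) Q3 mulr0.
  apply: contraT => m3.
  have /eqP : coprimez m 3 by rewrite coprimez_sym coprimezE prime_coprime.
  have [u [v <-]] := Bezoutz m 3 => /(congr1 (intmul (1 : Q))).
  rewrite intrD !intrM m0 -[3%:~R]/(3%:R : Q) Q3 !mulr0 addr0 => /esym/eqP.
  by rewrite oner_eq0.
have /cid[c cE] : exists c : Q -> int, forall x, x = (c x)%:~R.
  by exists (fun x => projT1 (cid (Qint x))) => x; case: cid.
pose k x : 'F_3 := (c x)%:~R.
have kE (m : int) : k m%:~R = m%:~R.
  apply/eqP; rewrite -subr_eq0 -rmorphB -Q0 rmorphB /= -cE subrr //.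
have kB : zmod_morphism k.
  by move=> x y; rewrite {1}[x]cE {1}[y]cE -rmorphB kE rmorphB.
have kM : monoid_morphism k.
  split=> [|x y]; first exact: (kE 1).
  by rewrite {1}[x]cE {1}[y]cE -intrM kE intrM.
exists (HB.pack_for {rmorphism Q -> 'F_3} k
  (GRing.isZmodMorphism.Build _ _ k kB) (GRing.isMonoidMorphism.Build _ _ k kM)).
exists (fun y : 'F_3 => (val y)%:R) => [x|y] /=.
  apply/eqP; rewrite -subr_eq0 [x in _ - x]cE pmulrn -rmorphB Q0 rmorphB /=.
  by rewrite -pmulrn natr_Zp subrr.
by rewrite pmulrn kE -pmulrn natr_Zp.
Qed.

Section Reduction.
Variable R : realType.
Local Notation C := R[i].
Local Notation s := (sqrtm2 R).
Local Notation Zs := (Zsqrtm2 R).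
Local Notation Zt := (Zsqrtm2V R).

Lemma sqrtm2_sqr : s ^+ 2 = -2.
Proof.
rewrite expr2 /sqrtm2; apply/eqP; rewrite eq_complex /=.
by rewrite !mul0r !mulr0 addr0 -expr2 sqr_sqrtr ?ler0n // sub0r oppr0 !eqxx.
Qed.

Lemma sqrtm2_neq0 : s != 0.
Proof. by rewrite -sqrf_eq0 sqrtm2_sqr oppr_eq0 pnatr_eq0. Qed.

Lemma sqrtm2VE : s^-1 = - (s / 2).
Proof.
apply: (mulfI sqrtm2_neq0); rewrite mulfV ?sqrtm2_neq0 // mulrN mulrA -expr2.
by rewrite sqrtm2_sqr mulNr divff ?opprK // pnatr_eq0.
Qed.

Lemma sqrtm2V_sqr : 2 * s^-1 ^+ 2 = -1.
Proof. by rewrite exprVn sqrtm2_sqr invrN mulrN mulfV // pnatr_eq0. Qed.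

Lemma sqrtm2V_lin (m n : int) : m%:~R + n%:~R * s^-1 = 0 :> C -> m = 0 /\ n = 0.
Proof.
move/(congr1 (fun z => z * s)); rewrite mul0r mulrDl mulfVK ?sqrtm2_neq0 //.
have mE (l : int) : l%:~R = (l%:~R)%:C%C :> C by rewrite rmorph_int.
rewrite !mE /sqrtm2 => -[]; rewrite /= !(mulr0, mul0r, subr0, add0r, addr0) oppr0 add0r.
move/eqP; rewrite intr_eq0 => /eqP -> /eqP.
by rewrite mulf_eq0 intr_eq0 sqrtr_eq0 lern0 orbF => /eqP ->.
Qed.

(** The linear remainder of [p] vanishes at 1/sqrt(-2), so both its coefficients are 0. This makes
    evaluation at [e] independent of the chosen polynomial once 2 is invertible. *)
Lemma ieval_sqrtm2V_eq0 (A : comNzRingType) (e : A) p :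
  2 * e ^+ 2 = -1 -> ieval s^-1 p = 0 -> exists k, 2 ^+ k * ieval e p = 0.
Proof.
move=> e2 p0; have [k [m [n E]]] := ieval_reduce p; exists k.
have := E _ _ sqrtm2V_sqr; rewrite p0 mulr0 => /esym/sqrtm2V_lin[m0 n0].
by rewrite E // m0 n0 mul0r addr0.
Qed.

Definition sqrtm2V_poly (z : Zt) : {poly int} :=
  projT1 (cid (in_intAdjP _ _ (valP z))).

Lemma sqrtm2V_polyE z : val z = ieval s^-1 (sqrtm2V_poly z).
Proof. by rewrite /sqrtm2V_poly; case: cid. Qed.

Section AtRoot.
Variable e : 'F_3.
Hypothesis e2 : 2 * e ^+ 2 = -1.

Definition redF3 (z : Zt) : 'F_3 := ieval e (sqrtm2V_poly z).

Lemma redF3E z p : val z = ieval s^-1 p -> redF3 z = ieval e p.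
Proof.
rewrite sqrtm2V_polyE => E; apply/eqP; rewrite -subr_eq0 -ievalB.
have [|k /eqP] := ieval_sqrtm2V_eq0 (p := sqrtm2V_poly z - p) e2.
  by rewrite ievalB E subrr.
by rewrite mulf_eq0 expf_eq0 andbF.
Qed.

Lemma redF3_zmod : zmod_morphism redF3.
Proof.
by move=> x y; rewrite -ievalB; apply: redF3E; rewrite ievalB -!sqrtm2V_polyE.
Qed.

Lemma redF3_monoid : monoid_morphism redF3.
Proof.
split=> [|x y]; first by rewrite -(ieval1 e); apply: redF3E; rewrite ieval1.
by rewrite -ievalM; apply: redF3E; rewrite ievalM -!sqrtm2V_polyE.
Qed.

End AtRoot.

Lemma intAdj_ieval (t : C) (z : intAdj t) : exists p, val z = ieval t p.
Proof. by have /in_intAdjP := valP z. Qed.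

Lemma gen_in_intAdj (t : C) : t \in in_intAdj t.
Proof. by apply/in_intAdjP; exists 'X; rewrite map_polyX hornerX. Qed.

Section Quotient.
Variable I : prime_idealr Zs.
Hypothesis I3 : 3%:R \in I.
Local Notation Q := {ideal_quot I}.

Definition gen_Zs : Zs := IntAdj (gen_in_intAdj s).

Lemma gen_Zs_sqr : gen_Zs ^+ 2 = - 2%:R.
Proof. by apply: val_inj; rewrite rmorphXn rmorphN rmorph_nat /= sqrtm2_sqr. Qed.

(** In the quotient, a domain, sqrt(-2) has square -2 = 1; so it becomes 1 or -1, and every class
    contains an integer. *)
Lemma ideal_quot_F3 : exists k : {rmorphism Q -> 'F_3}, bijective k.
Proof.
have Q3 : 3%:R = 0 :> Q.
  have : \pi_Q%qT (3%:R : Zs) = 0.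
    by apply/eqP; rewrite piE Quotient.equivE subr0.
  by rewrite rmorph_nat.
apply: prime_ring_F3 => // x.
have [p xE] : exists p, x = ieval (\pi_Q%qT gen_Zs : Q) p.
  have [p pE] := intAdj_ieval (generic_quotient.repr x); exists p.
  rewrite -[LHS]generic_quotient.reprK -ieval_morph; congr (\pi_Q%qT _).
  by apply: val_inj; rewrite pE (ieval_morph val).
have e2 : (\pi_Q%qT gen_Zs : Q) ^+ 2 = 1.
  rewrite -rmorphXn /= gen_Zs_sqr rmorphN rmorph_nat.
  by apply/eqP; rewrite -subr_eq0 -opprD oppr_eq0 natr1 Q3.
have : (\pi_Q%qT gen_Zs - 1 : Q) * (\pi_Q%qT gen_Zs + 1) = 0.
  by rewrite -subr_sqr e2 expr1n subrr.
move/Quotient.rquot_IdomainAxiom; rewrite subr_eq0 addr_eq0 xE => /orP[]/eqP->.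
  by exists (ieval 1 p); rewrite (ieval_morph intr).
by exists (ieval (-1) p); rewrite (ieval_morph intr) rmorphN.
Qed.

Lemma sqrtm2_redF3 (k : {rmorphism Q -> 'F_3}) :
  2 * k (\pi_Q%qT gen_Zs) ^+ 2 = -1.
Proof.
rewrite -!rmorphXn /= gen_Zs_sqr.
by rewrite !rmorphN !rmorph_nat; apply/eqP.
Qed.

Lemma extends_quotient_exists :
  exists q : {rmorphism Zt -> Q}, extends_quotient q.
Proof.
have [k [k' kK k'K]] := ideal_quot_F3.
(* As s = -2 s^-1 and -2 = 1 in F_3, the image of s^-1 has to be that of s. *)
pose K := redF3 (k (\pi_Q%qT gen_Zs)).
have kI := can_inj kK.
pose q z := k' (K z).
have qB : zmod_morphism q.
  by move=> x y; apply: kI; rewrite rmorphB !k'K /K redF3_zmod //; exact: sqrtm2_redF3.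
have qM : monoid_morphism q.
  have [K1 KM] := redF3_monoid (sqrtm2_redF3 k).
  split=> [|x y]; apply: kI; first by rewrite rmorph1 !k'K.
  by rewrite rmorphM !k'K; exact: KM.
exists (HB.pack_for {rmorphism Zt -> Q} q
  (GRing.isZmodMorphism.Build _ _ q qB) (GRing.isMonoidMorphism.Build _ _ q qM)).
move=> x y xy; apply: kI; rewrite /= k'K.
have [p pE] := intAdj_ieval x.
(* Substituting -2 X turns a polynomial in s into one in s^-1 with the same value. *)
rewrite /K (redF3E (sqrtm2_redF3 k) (p := p \Po ((-2)%:P * 'X))).
  rewrite ieval_comp; have -> : x = ieval gen_Zs p.
    by apply: val_inj; rewrite pE (ieval_morph val).
  have -> : \pi_Q%qT (ieval gen_Zs p) = ieval (\pi_Q%qT gen_Zs) p.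
    by rewrite -ieval_morph.
  rewrite (ieval_morph k); congr ieval.
  by rewrite ieval_CX -[RHS]mul1r; congr (_ * _); apply/eqP.
rewrite -xy pE ieval_comp; congr ieval.
rewrite ieval_CX (_ : (-2)%:~R = - 2%:R :> C) //.
by rewrite mulNr sqrtm2VE mulrN opprK mulrC divfK // pnatr_eq0.
Qed.

End Quotient.

Definition gen_Zt : Zt := IntAdj (gen_in_intAdj s^-1).

Lemma gen_Zt_sqr : 2 * gen_Zt ^+ 2 = -1.
Proof.
by apply: val_inj; rewrite rmorphM rmorphXn rmorph_nat rmorphN1 /= sqrtm2V_sqr.
Qed.

End Reduction.

Lemma redF3_exists (R : realType) (e : 'F_3) : 2 * e ^+ 2 = -1 ->
  exists k : {rmorphism Zsqrtm2V R -> 'F_3}, k (gen_Zt R) = e.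
Proof.
move=> e2; exists (HB.pack_for {rmorphism Zsqrtm2V R -> 'F_3} (@redF3 R e)
  (GRing.isZmodMorphism.Build _ _ _ (@redF3_zmod R e e2))
  (GRing.isMonoidMorphism.Build _ _ _ (@redF3_monoid R e e2))).
rewrite /= (redF3E e2 (p := 'X)) /ieval ?map_polyX ?hornerX //.
Qed.

(** * Computation with matrices over Z[1/sqrt(-2)] *)

Section PairArithmetic.

(** The pair (m, n) encodes m + n sqrt(-2), so that ring identities become integer computations. *)
Definition zpair := (int * int)%type.
Implicit Types p q z : zpair.

Definition zadd p q : zpair := (p.1 + q.1, p.2 + q.2).
Definition zopp p : zpair := (- p.1, - p.2).
Definition zmul p q : zpair :=
  (p.1 * q.1 - 2 * (p.2 * q.2), p.1 * q.2 + p.2 * q.1).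
Definition zsum (f : nat -> zpair) n : zpair :=
  foldr zadd (0, 0) (map f (iota 0 n)).

Variables (A : comNzRingType) (u : A).

Definition zval z : A := z.1%:~R - 2 * (z.2%:~R * u).
(* As 2 u^2 = -1, u stands for the inverse of a square root s = -2 u of -2,
   and z for (z.1 + z.2 s) / 2. *)
Definition hval z : A := - u ^+ 2 * zval z.

Lemma zval0 : zval (0, 0) = 0.
Proof. by rewrite /zval /= mul0r mulr0 subr0. Qed.

Lemma zvalD p q : zval (zadd p q) = zval p + zval q.
Proof. by rewrite /zval /= !intrD; ring. Qed.

Lemma zvalN p : zval (zopp p) = - zval p.
Proof. by rewrite /zval /= !mulrNz; ring. Qed.

Lemma zval_sum f n : zval (zsum f n) = \sum_(i < n) zval (f i).
Proof.
rewrite /zsum -(big_mkord xpredT (fun i => zval (f i))) /index_iota subn0.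
elim: (iota 0 n) => [|i r IH] /=; first by rewrite big_nil zval0.
by rewrite big_cons zvalD IH.
Qed.

Hypothesis u2 : 2 * u ^+ 2 = -1.

Lemma zvalM p q : zval (zmul p q) = zval p * zval q.
Proof.
rewrite /zval /= !(intrD, intrM, mulrNz).
transitivity ((p.1%:~R - 2 * (p.2%:~R * u)) * (q.1%:~R - 2 * (q.2%:~R * u))
  - 2 * (p.2%:~R * q.2%:~R) * (2 * u ^+ 2 + 1)); first by ring.
by rewrite u2 addNr mulr0 subr0.
Qed.

Lemma hval2 z : 2 * hval z = zval z.
Proof. by rewrite /hval mulrA mulrN u2 opprK mul1r. Qed.

(** Multiplication by -u^2 undoes doubling. *)
Lemma half_inj (x y : A) : 2 * x = 2 * y -> x = y.
Proof.
move/(congr1 ( *%R (- u ^+ 2))); rewrite !mulrA.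
have -> : - u ^+ 2 * 2 = 1 by rewrite mulNr mulrC u2 opprK.
by rewrite !mul1r.
Qed.

End PairArithmetic.

Section ListMatrices.

Definition cmat := seq (seq zpair).
Implicit Types M N L : cmat.

Definition entry M i j : zpair := nth (0, 0) (nth [::] M i) j.
Definition build m n (f : nat -> nat -> zpair) : cmat :=
  mkseq (fun i => mkseq (f i) n) m.

Lemma entry_build m n f (i : 'I_m) (j : 'I_n) : entry (build m n f) i j = f i j.
Proof. by rewrite /entry /build !nth_mkseq. Qed.

Definition prod_entry n M N i j : zpair :=
  zsum (fun k => zmul (entry M i k) (entry N k j)) n.

(* Entries are halved numerators, hence the factor 2. *)
Definition is_prod (test : pred zpair) m n p M N L : bool :=
  all (fun i => all (fun j =>
    test (zadd (prod_entry n M N i j) (zopp (zmul (2 : int, 0) (entry L i j)))))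
    (iota 0 p)) (iota 0 m).

(** Laplace expansion along the first row; [bump j] skips column [j]. *)
Fixpoint cdet n (f : nat -> nat -> zpair) : zpair :=
  if n is m.+1 then
    zsum (fun j => zmul (f 0%N j)
      (zmul ((-1) ^+ j, 0) (cdet m (fun i k => f i.+1 (bump j k))))) n
  else (1, 0).

Variables (A : comNzRingType) (u : A).
Hypothesis u2 : 2 * u ^+ 2 = -1.

Definition mx m n M : 'M[A]_(m, n) := \matrix_(i, j) hval u (entry M i j).

(** With the zero test as a parameter, one computation certifies products both over Z[1/sqrt(-2)]
    and over F_3. *)
Lemma is_prodE (test : pred zpair) m n p M N L :
  (forall z, test z = (zval u z == 0)) ->
  is_prod test m n p M N L = (mx m n M *m mx n p N == mx m p L).
Proof.
move=> testE.
have E (i : 'I_m) (j : 'I_p) : test (zadd (prod_entry n M N i j)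
    (zopp (zmul (2 : int, 0) (entry L i j)))) =
    ((mx m n M *m mx n p N) i j == mx m p L i j).
  rewrite testE zvalD zvalN zval_sum zvalM // subr_eq0 !mxE.
  have z2 : zval u (2 : int, 0) = 2 by rewrite /zval /= mul0r mulr0 subr0.
  have -> : \sum_(k < n) zval u (zmul (entry M i k) (entry N k j)) =
      2 * (2 * \sum_k mx m n M i k * mx n p N k j).
    rewrite !mulr_sumr; apply: eq_bigr => k _.
    by rewrite !mxE zvalM // -(hval2 u2) -(hval2 u2 (entry N k j)); ring.
  rewrite z2 -(hval2 u2 (entry L i j)).
  by apply/eqP/eqP => [/(half_inj u2)/(half_inj u2)|-> //].
apply/allP/eqP => [allt|MN i].
  apply/matrixP => i j; apply/eqP; rewrite -E.
  have im : (i : nat) \in iota 0 m by rewrite mem_iota ltn_ord.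
  have jp : (j : nat) \in iota 0 p by rewrite mem_iota ltn_ord.
  exact: allP (allt _ im) _ jp.
rewrite mem_iota => /= im; apply/allP => j; rewrite mem_iota => /= jp.
by rewrite (E (Ordinal im) (Ordinal jp)) MN.
Qed.

Lemma is_prod_imp (test : pred zpair) m n p M N L :
  (forall z, test z -> zval u z = 0) -> is_prod test m n p M N L ->
  mx m n M *m mx n p N = mx m p L.
Proof.
move=> test0 tMN; apply/eqP; rewrite -(is_prodE (test := fun z => zval u z == 0)) //.
apply/allP => i im; apply/allP => j jp; apply/eqP/test0.
exact: allP (allP tMN _ im) _ jp.
Qed.

(** Each of the [n] rows carries a factor 1/2, that is -u^2. *)
Lemma hval_det n (f : nat -> nat -> zpair) :
  \det (\matrix_(i < n, j < n) hval u (f i j)) =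
  (- u ^+ 2) ^+ n * zval u (cdet n f).
Proof.
elim: n f => [|n IH] f.
  by rewrite det_mx00 expr0 mul1r /zval /=; ring.
rewrite (expand_det_row _ ord0) zval_sum mulr_sumr; apply: eq_bigr => j _.
rewrite -/(cdet n) mxE /cofactor !zvalM //.
rewrite (_ : row' _ _ = \matrix_(i, k) hval u (f i.+1 (bump j k))); last first.
  by apply/matrixP => i k; rewrite !mxE.
rewrite (IH (fun i k => f i.+1 (bump j k))) /hval add0n.
have -> : zval u ((-1) ^+ j, 0) = (-1) ^+ j.
  by rewrite /zval /= mul0r mulr0 subr0 rmorphXn rmorphN1.
rewrite [in RHS](exprS (- u ^+ 2)); move: (cdet n _) => d; ring.
Qed.

Lemma det_mx1 n M : cdet n (entry M) = ((2 ^ n)%N : int, 0 : int) ->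
  \det (mx n n M) = 1.
Proof.
move=> dM; rewrite /mx hval_det dM /zval /= mul0r mulr0 subr0 -pmulrn natrX.
by rewrite -exprMn mulNr mulrC u2 opprK expr1n.
Qed.

End ListMatrices.

Lemma map_mx_mx (A B : comNzRingType) (h : {rmorphism A -> B}) u m n M :
  map_mx h (mx u m n M) = mx (h u) m n M.
Proof.
apply/matrixP => i j; rewrite !mxE /hval /zval.
by rewrite rmorphM rmorphN rmorphXn rmorphB !rmorphM !rmorph_int rmorph_nat.
Qed.

Section Data.
(** Entries are doubled: [I], [J], [h], [g] encode 1, -1, 1/2, -1/2, and 1/sqrt(-2) = -sqrt(-2)/2 is
    encoded by (0, -1). *)
Let O : zpair := (0, 0).
Let I : zpair := (2, 0).
Let J : zpair := (-2, 0).
Let h : zpair := (1, 0).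
Let g : zpair := (-1, 0).

Definition ca : cmat :=
  [:: [:: J; O; O; O; O]; [:: O; J; O; O; O]; [:: O; O; I; O; O];
      [:: O; O; O; O; J]; [:: O; O; O; I; O]].
Definition cb : cmat :=
  [:: [:: J; O; O; O; O]; [:: O; I; O; O; O]; [:: O; O; I; O; O];
      [:: O; O; O; I; O]; [:: O; O; O; O; J]].
Definition cc : cmat :=
  [:: [:: h; g; (0, 1); O; O]; [:: h; g; (0, -1); O; O];
      [:: (0, -1); (0, -1); O; O; O];
      [:: O; O; O; (-1, -1); g]; [:: O; O; O; h; (-1, 1)]].
Definition cd : cmat :=
  [:: [:: O; O; O; I; O]; [:: O; g; (-1, -1); O; O];
      [:: O; (1, -1); g; O; O]; [:: O; O; O; O; I]; [:: I; O; O; O; O]].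
Definition c1 : cmat :=
  [:: [:: I; O; O; O; O]; [:: O; I; O; O; O]; [:: O; O; I; O; O];
      [:: O; O; O; I; O]; [:: O; O; O; O; I]].
End Data.

Lemma mx_c1 (A : comNzRingType) (u : A) : 2 * u ^+ 2 = -1 -> mx u 5 5 c1 = 1%:M.
Proof.
move=> u2; apply/matrixP => i j; rewrite !mxE; apply: (half_inj u2).
have : all (fun i => all (fun j =>
    entry c1 i j == ((2 * (i == j))%N : int, 0)) (iota 0 5)) (iota 0 5) by [].
move=> /allP/(_ i); rewrite mem_iota ltn_ord => /(_ isT).
move=> /allP/(_ j); rewrite mem_iota ltn_ord => /(_ isT)/eqP ->.
by rewrite hval2 // /zval /= mul0r mulr0 subr0 -pmulrn natrM.
Qed.

Definition exact0 : pred zpair := pred1 (0, 0).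
Definition exact_prod := is_prod exact0 5 5 5.

Definition halfz (m : int) : int :=
  match m with Posz n => Posz n./2 | Negz n => Negz n./2 end.

(** Halving is exact only for even numerators, so this proposes a product that [exact_prod] then
    certifies. *)
Definition cmul (M N : cmat) : cmat := build 5 5 (fun i j =>
  let z := prod_entry 5 M N i j in (halfz z.1, halfz z.2)).

Definition conj_transpose (M : cmat) : cmat := build 5 5 (fun i j =>
  let z := entry M j i in (z.1, - z.2)).

Definition close_step (gs l : seq cmat) : seq cmat := undup (l ++
  flatten [seq [seq N <- [seq cmul M g | g <- gs] |
    has (fun g => exact_prod M g N) gs] | M <- l]).

Definition closure n gs := iter n (close_step gs) [:: c1].

Definition wf_mx (M : cmat) := (size M == 5%N) && all (fun r => size r == 5%N) M.

(** For unitary generators the conjugate transposes are the inverses, so the list is stable under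
    right multiplication by the generated group. *)
Definition closed_list (gs l : seq cmat) := [&& c1 \in l, uniq l, all wf_mx l &
  all (fun M => all (fun g => let N := cmul M g in (N \in l) && exact_prod M g N)
    (gs ++ map conj_transpose gs)) l].

Section Unitary.
Variable R : realType.
Local Notation C := R[i].
Local Notation t := ((sqrtm2 R)^-1).
Local Notation Zt := (Zsqrtm2V R).
Local Notation tau := (gen_Zt R).
Local Notation mxt := (@mx Zt tau 5 5).

Lemma exact0_C z : exact0 z = (zval t z == 0).
Proof.
apply/eqP/eqP => [->|]; first exact: zval0.
rewrite /zval => E; have := @sqrtm2V_lin R z.1 (- 2 * z.2).
rewrite mulNr mulrNz intrM mulNr -[2%:~R]/(2%:R : C) -mulrA => /(_ E)[z1 /eqP].
by rewrite oppr_eq0 mulf_eq0 /= => /eqP z2; rewrite [z]surjective_pairing z1 z2.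
Qed.

Lemma zval_val z : val (zval tau z) = zval t z.
Proof.
by rewrite /zval rmorphB !rmorphM !rmorph_int rmorph_nat.
Qed.

Lemma exact0_Zt z : exact0 z = (zval tau z == 0).
Proof.
by rewrite exact0_C -zval_val; apply/eqP/eqP => [E|->]; first exact: val_inj.
Qed.

Lemma exact_prodE M N L : exact_prod M N L = (mxt M *m mxt N == mxt L).
Proof. apply: is_prodE; [exact: gen_Zt_sqr | exact: exact0_Zt]. Qed.

(** Since 1 and sqrt(-2) are independent over Z, an entry determines its pair; the sizes exclude
    lists that differ only by default entries. *)
Lemma mxt_inj M N : wf_mx M -> wf_mx N -> mxt M = mxt N -> M = N.
Proof.
move=> /andP[/eqP sM /allP rM] /andP[/eqP sN /allP rN] E.
apply: (@eq_from_nth _ [::]); rewrite ?sM ?sN // => i i5.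
have /eqP sMi := rM _ (mem_nth [::] (n := i) (s := M) ltac:(by rewrite sM)).
have /eqP sNi := rN _ (mem_nth [::] (n := i) (s := N) ltac:(by rewrite sN)).
apply: (@eq_from_nth _ (0, 0)); rewrite ?sMi ?sNi // => j j5.
have := congr1 (fun X : 'M_5 => 2 * X (Ordinal i5) (Ordinal j5)) E.
rewrite /= !mxE !hval2 /= ?gen_Zt_sqr //.
rewrite -/(entry M i j) -/(entry N i j).
move: (entry M i j) (entry N i j) => z z' /eqP.
rewrite -subr_eq0 -zvalN -zvalD -exact0_Zt => /eqP[].
by case: z z' => x y [x' y'] /= /eqP + /eqP; rewrite !subr_eq0 => /eqP-> /eqP->.
Qed.

Lemma conj_sqrtm2V : Num.conj t = - t.
Proof.
rewrite fmorphV -invrN; congr (_^-1).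
by rewrite /sqrtm2; apply/eqP; rewrite eq_complex /= oppr0 !eqxx.
Qed.

Lemma conj_mx_tr M : (map_mx Num.conj (mx t 5 5 M))^T = mx t 5 5 (conj_transpose M).
Proof.
have -> : map_mx Num.conj (mx t 5 5 M) = mx (- t) 5 5 M.
  by rewrite -conj_sqrtm2V; exact: map_mx_mx.
apply/matrixP => i j; rewrite !mxE /conj_transpose entry_build /hval /zval /= mulrNz.
by ring.
Qed.

Definition is_special_unitary M :=
  (cdet 5 (entry M) == (32%N : int, 0 : int)) && exact_prod M (conj_transpose M) c1.

Lemma toC_mxt M : toC (mxt M) = mx t 5 5 M.
Proof. exact: (map_mx_mx (val : {rmorphism Zt -> C})). Qed.

Lemma in_SU_mxt M : is_special_unitary M -> in_SU (mxt M).
Proof.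
case/andP=> /eqP dM; rewrite exact_prodE => /eqP uM.
rewrite /in_SU det_mx1 ?gen_Zt_sqr // eqxx toC_mxt conj_mx_tr -!toC_mxt -toCM uM.
by rewrite mx_c1 ?gen_Zt_sqr // toC1 eqxx.
Qed.

Definition SU_of M (uM : is_special_unitary M) : SU5 R := MkSU (in_SU_mxt uM).

Definition gen_a : SU5 R := @SU_of ca isT.
Definition gen_b : SU5 R := @SU_of cb isT.
Definition gen_c : SU5 R := @SU_of cc isT.
Definition gen_d : SU5 R := @SU_of cd isT.
End Unitary.

(** The elements that satisfy [S] together with their inverses form a subgroup. *)
Lemma gen_subset_prop (X : groupType) (gens : seq X) (S : X -> Prop) :
  S 1%g -> (forall x y, S x -> S y -> S (x * y)%g) ->
  (forall x, x \in gens -> S x /\ S x^-1%g) ->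
  forall x, x \in gen gens -> S x.
Proof.
move=> S1 SM Sg x /genP/(_ (fun y => `[< S y /\ S y^-1%g >])) Px.
suff /asboolP[] : x \in (fun y => `[< S y /\ S y^-1%g >]) by [].
apply: Px => [|y /Sg Sy]; last exact/asboolP.
split; first by apply/asboolP; rewrite invg1.
move=> y z /asboolP[sy sy'] /asboolP[sz sz']; apply/asboolP.
by rewrite invgM invgK; split; exact: SM.
Qed.

Lemma gens_in_gen (X : groupType) (gens : seq X) x : x \in gens -> x \in gen gens.
Proof. by move=> xg; apply/genP => P _ /(_ _ xg). Qed.

(** * Enumeration of the finite subgroups *)

Section Generators.
Variable R : realType.
Local Notation C := R[i].
Local Notation t := ((sqrtm2 R)^-1).
Local Notation Zt := (Zsqrtm2V R).
Local Notation tau := (gen_Zt R).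
Local Notation mxt := (@mx Zt tau 5 5).
Local Notation SU := (SU5 R).

Lemma mxt_rows M (rows : seq (seq C)) :
  (forall i j, (i < 5)%N -> (j < 5)%N ->
    hval t (entry M i j) = nth 0 (nth [::] rows i) j) ->
  toC (mxt M) = mx_of_rows rows.
Proof. by move=> E; rewrite toC_mxt; apply/matrixP => i j; rewrite !mxE E. Qed.

Lemma hval_sqrtm2V z : hval t z = (z.1%:~R + z.2%:~R * sqrtm2 R) / 2.
Proof.
apply: (half_inj (sqrtm2V_sqr R)); rewrite hval2 ?sqrtm2V_sqr //.
rewrite [2 * (_ / _)]mulrC divfK ?pnatr_eq0 // /zval sqrtm2VE.
rewrite mulrN mulrN opprK [2 * _]mulrC mulrA divfK ?pnatr_eq0 //.
Qed.

Ltac matrix_entries := apply: mxt_rows;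
  move=> [|[|[|[|[|i]]]]] [|[|[|[|[|j]]]]] // _ _;
  rewrite hval_sqrtm2V /= ?mulN1r ?div1r ?sqrtm2VE; field; exact: isT.

Lemma toC_gen_a : toC (val (gen_a R)) = mxa R.
Proof. matrix_entries. Qed.

Lemma toC_gen_b : toC (val (gen_b R)) = mxb R.
Proof. matrix_entries. Qed.

Lemma toC_gen_c : toC (val (gen_c R)) = mxc R.
Proof. matrix_entries. Qed.

Lemma toC_gen_d : toC (val (gen_d R)) = mxd R.
Proof. matrix_entries. Qed.

Section Enumeration.
Variables (gens : seq SU) (cgens : seq cmat) (l : seq cmat) (n : nat).
Hypothesis cgens_gens : [seq val x | x <- gens] = [seq mxt M | M <- cgens].
Hypothesis unitary_gens : all is_special_unitary cgens.
Hypothesis l_closed : closed_list cgens l.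

Lemma gens_cgens x : x \in gens -> exists2 M, M \in cgens & val x = mxt M.
Proof.
move=> xg; have : val x \in [seq val x | x <- gens] by exact: map_f.
by rewrite cgens_gens => /mapP.
Qed.

Lemma cgens_gens_ex M : M \in cgens -> exists2 x, x \in gens & val x = mxt M.
Proof.
move=> Mg; have : mxt M \in [seq mxt M | M <- cgens] by exact: map_f.
by rewrite -cgens_gens => /mapP[x xg xM]; exists x.
Qed.

Lemma val_SUM (x y : SU) : val (x * y)%g = val x *m val y.
Proof. by []. Qed.

Lemma val_SUV M N (x : SU) : val x = mxt M -> exact_prod M N c1 ->
  val (x^-1)%g = mxt N.
Proof.
move=> xM; rewrite (exact_prodE R) (mx_c1 (gen_Zt_sqr R)) => /eqP MN.
have : val (x^-1 * x)%g = 1%:M by rewrite mulVg.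
rewrite val_SUM => /(congr1 (mulmx^~ (mxt N))).
by rewrite mul1mx -mulmxA xM MN mulmx1.
Qed.

Lemma gen_enum x : x \in gen gens -> exists2 M, M \in l & val x = mxt M.
Proof.
case/and4P: l_closed => l1 _ _ /allP lc.
(* Applied to the identity matrix, which is listed, stability under [x] puts the matrix of [x] in
   the list. *)
pose stab (y : SU) := forall M, M \in l -> exists2 N, N \in l & mxt M *m val y = mxt N.
have stab1 : stab 1%g by move=> M Ml; exists M; [exact: Ml | exact: mulmx1].
have stabM y z : stab y -> stab z -> stab (y * z)%g.
  move=> sy sz M /sy[N Nl MN]; have [L Ll NL] := sz _ Nl.
  by exists L; [exact: Ll | rewrite val_SUM mulmxA MN].
have stabl M y : val y = mxt M -> M \in cgens ++ map conj_transpose cgens -> stab y.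
  move=> yM Mg N /lc/allP/(_ _ Mg)/andP[Nl]; rewrite (exact_prodE R) => /eqP E.
  by exists (cmul N M); [exact: Nl | rewrite yM].
have stab_gens y : y \in gens -> stab y /\ stab y^-1%g.
  move=> /gens_cgens[M Mg yM]; split.
    by apply: stabl yM _; rewrite mem_cat Mg.
  apply: (stabl (conj_transpose M)); last by rewrite mem_cat map_f ?orbT.
  by apply: val_SUV yM _; have /allP/(_ _ Mg)/andP[] := unitary_gens.
move=> xg; have sx : stab x := gen_subset_prop stab1 stabM stab_gens xg.
have [M Ml E] := sx _ l1.
exists M; first exact: Ml.
by rewrite -E (mx_c1 (gen_Zt_sqr R)) mul1mx.
Qed.

Hypothesis lE : l = closure n cgens.

(** Each round of [closure] adds only certified products of an earlier matrix with a generator. *)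
Lemma enum_gen M : M \in l -> exists2 x, x \in gen gens & val x = mxt M.
Proof.
rewrite lE; elim: (n) M => [|m IH] M.
  rewrite inE => /eqP ->; exists 1%g; first exact: gen1.
  by rewrite (mx_c1 (gen_Zt_sqr R)).
rewrite /closure iterS /close_step mem_undup mem_cat => /orP[/IH //|].
move=> /flattenP[Ns /mapP[N /IH[x xg xN] ->]].
rewrite mem_filter => /andP[/hasP[g gg]].
rewrite (exact_prodE R) => /eqP NgM _; have [y yg yE] := cgens_gens_ex gg.
exists (x * y)%g; last by rewrite val_SUM xN yE.
by apply: gpredM; [exact: xg | exact: gens_in_gen].
Qed.

Lemma subgrp_SU_inj (x y : subgrp (gen gens)) :
  SU_val (subgrp_val x) = SU_val (subgrp_val y) -> x = y.
Proof. by move=> E; apply: val_inj; apply: val_inj. Qed.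

Definition enum_elt M : subgrp (gen gens) :=
  classical_sets.xget 1%g (fun x : subgrp (gen gens) => SU_val (subgrp_val x) = mxt M).

Lemma enum_eltE M : M \in l -> SU_val (subgrp_val (enum_elt M)) = mxt M.
Proof.
move=> /enum_gen[x xg xM].
apply: (@classical_sets.xgetPex _ 1%g (fun x : subgrp (gen gens) => val (val x) = mxt M)).
by exists (Subgrp xg).
Qed.

Lemma enum_elts : exists xs : seq (subgrp (gen gens)),
  [/\ uniq xs, size xs = size l & forall x, x \in xs].
Proof.
case/and4P: (l_closed) => _ ul /allP wl _.
exists (map enum_elt l); split.
- rewrite map_inj_in_uniq; first exact: ul.
  move=> M N Ml Nl MN.
  have E : mxt M = mxt N by rewrite -(enum_eltE Ml) -(enum_eltE Nl) MN.
  exact: mxt_inj (wl _ Ml) (wl _ Nl) E.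
- exact: size_map.
move=> x; have [M Ml xM] := gen_enum (valP x).
have -> : x = enum_elt M.
  by apply: subgrp_SU_inj; rewrite (enum_eltE Ml).
exact: map_f.
Qed.

End Enumeration.
End Generators.

(** * Homomorphisms to finite groups *)

Lemma hom_inj (G X : groupType) (f : {multiplicative G -> X}) :
  (forall x, f x = 1%g -> x = 1%g) -> injective f.
Proof.
move=> f1 x y fxy; apply: (mulIg y^-1%g); rewrite mulgV.
by apply: f1; rewrite gmulfM mulg_homV fxy mulgV.
Qed.

Lemma card_hom_image (G : groupType) (gT : finGroupType)
    (f : {multiplicative G -> gT}) (S : {set gT}) (xs : seq G) :
  injective f -> uniq xs -> (forall x, x \in xs) -> hom_onto f S -> #|S| = size xs.
Proof.
move=> f_inj u_xs all_xs fS; rewrite -(size_map f) -(card_uniqP _).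
  apply: eq_card => s; apply/idP/mapP => [/fS[x <-]|[x _ ->]].
    by exists x.
  by apply/fS; exists x.
by rewrite map_inj_uniq.
Qed.

Lemma hom_image_group (G : groupType) (gT : finGroupType)
    (f : {multiplicative G -> gT}) : exists D : {group gT}, hom_onto f D.
Proof.
pose D := [set s | `[< exists x, f x = s >]].
have memD s : reflect (exists x, f x = s) (s \in D).
  by rewrite inE; exact: asboolP.
have gD : group_set D.
  apply/group_setP; split; first by apply/memD; exists 1%g; exact: mulg_hom1.
  move=> s s' /memD[x <-] /memD[y <-].
  by apply/memD; exists (x * y)%g; exact: gmulfM.
by exists (Group gD) => s; split=> /memD.
Qed.

Lemma iso_fin_card (G : groupType) (gT : finGroupType) (S : {group gT})
    (f : {multiplicative G -> gT}) (xs : seq G) :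
  injective f -> uniq xs -> (forall x, x \in xs) -> (forall x, f x \in S) ->
  size xs = #|S| -> iso_fin G S.
Proof.
move=> f_inj u_xs all_xs fS sz; have [D fD] := hom_image_group f.
have DS : D = S :> {set gT}.
  apply/eqP; rewrite eqEcard (card_hom_image f_inj u_xs all_xs fD) sz leqnn andbT.
  by apply/subsetP => s /fD[x <-].
by exists f; split; last by rewrite -DS.
Qed.

Lemma iso_fin_isog (G : groupType) (gT hT : finGroupType) (S : {group gT})
    (T : {group hT}) : iso_fin G S -> S \isog T -> iso_fin G T.
Proof.
move=> [f [f_inj fS]] /isogP[h h_inj hS].
have fxS x : f x \in S by apply/fS; exists x.
have hfM : {morph (fun x => h (f x)) : x y / (x * y)%g}.
  by move=> x y; rewrite gmulfM morphM.
pose hf : {multiplicative G -> hT} := HB.pack_for {multiplicative G -> hT}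
  (fun x => h (f x)) (isMultiplicative.Build G hT (fun x => h (f x)) hfM).
exists hf; split.
  by move=> x y /= /(injmP h_inj _ _ (fxS x) (fxS y)) /f_inj.
move=> s; rewrite -hS; split.
  by case/morphimP => z _ /fS[x <-] ->; exists x.
by case=> x <-; apply: mem_morphim.
Qed.

(** By its presentation, the dihedral group maps onto [D], and the orders agree. *)
Lemma dihedral8_isog (gT : finGroupType) (D : {group gT}) x y :
  #|D| = 8%N -> D = (<[x]> <*> <[y]>)%g :> {set gT} ->
  (x ^+ 4 = 1 -> y ^+ 2 = 1 -> x ^ y = x^-1 -> D \isog 'D_8)%g.
Proof.
move=> D8 Dxy x4 y2 xy; rewrite -[8%N]/(2 ^ 3)%N.
rewrite isogEcard card_2dihedral // D8 leqnn andbT Grp_2dihedral //.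
by apply/existsP; exists (x, y) => /=; rewrite -Dxy !xpair_eqE x4 y2 xy !eqxx.
Qed.

Lemma hom_to_GL (G : groupType) (f : G -> 'M['F_3]_2) :
  f 1%g = 1%:M -> (forall x y, f (x * y)%g = f x *m f y) ->
  exists F : {multiplicative G -> {'GL_2['F_3]}}, forall x, GLval (F x) = f x.
Proof.
move=> f1 fM; have fU x : f x \in unitmx.
  have fxV : f x *m f x^-1%g = 1%:M by rewrite -fM mulgV; exact: f1.
  by have [fxu _] := mulmx1_unit fxV; exact: fxu.
have fU' x : f x \is a GRing.unit := fU x.
pose F x : {'GL_2['F_3]} := insubd (1%g : {'GL_2['F_3]}) (f x).
have FE x : val (F x) = f x by rewrite /F val_insubd fU'.
have FM : {morph F : x y / (x * y)%g}.
  by move=> x y; apply: val_inj; rewrite FE fM -!FE.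
by exists (HB.pack_for {multiplicative G -> {'GL_2['F_3]}} F
  (isMultiplicative.Build G _ F FM)).
Qed.

(** If 1/sqrt(-2) reduces to [e], so does sqrt(-2) = -2/sqrt(-2), because -2 = 1 modulo 3. *)
Definition mod3 (e : int) (z : zpair) : bool := (3 %| (z.1 + e * z.2)%R)%Z.

Lemma mod3E e z : mod3 e z = (zval (e%:~R : 'F_3) z == 0).
Proof.
rewrite /mod3 -intr_F3_eq0 intrD intrM /zval; congr (_ == 0).
have -> : 2 = -1 :> 'F_3 by apply/eqP.
by rewrite mulN1r opprK mulrC.
Qed.

Definition is_sign (e : int) : bool := (e == 1) || (e == -1).

Lemma sign_F3 e : is_sign e -> 2 * (e%:~R : 'F_3) ^+ 2 = -1.
Proof. by case/orP=> /eqP ->; apply/eqP. Qed.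

(** * Permutations of lines over F_3 *)

Section Lines.
Variables (F : fieldType) (n m : nat) (line : 'I_n -> 'rV[F]_m).

(** Over F_3 the only nonzero scalars are 1 and -1. *)
Definition same_line (v w : 'rV[F]_m) : Prop := v = w \/ v = - w.

Lemma same_line_sym v w : same_line v w -> same_line w v.
Proof. by case=> ->; [left | right; rewrite opprK]. Qed.

Lemma same_line_trans v w x : same_line v w -> same_line w x -> same_line v x.
Proof.
by case=> -> [] ->; rewrite ?opprK; [left | right | right | left].
Qed.

Lemma same_line_mul v w g : same_line v w -> same_line (v *m g) (w *m g).
Proof. by case=> ->; rewrite ?mulNmx; [left | right]. Qed.

Definition permutes_lines (p : 'S_n) (g : 'M[F]_m) : Prop :=
  forall i, same_line (line i *m g) (line (p i)).

Lemma permutes_lines1 : permutes_lines 1%g 1%:M.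
Proof. by move=> i; rewrite perm1 mulmx1; left. Qed.

Lemma permutes_linesM p q g h : permutes_lines p g -> permutes_lines q h ->
  permutes_lines (p * q)%g (g *m h).
Proof.
move=> pg qh i; rewrite permM mulmxA.
exact: same_line_trans (same_line_mul h (pg i)) (qh (p i)).
Qed.

Lemma permutes_linesV p g h : g *m h = 1%:M -> permutes_lines p g ->
  permutes_lines p^-1%g h.
Proof.
move=> gh pg i; have := same_line_mul h (pg (p^-1 i)%g).
by rewrite permKV -mulmxA gh mulmx1 => /same_line_sym.
Qed.

Hypothesis line_inj : forall i j, same_line (line i) (line j) -> i = j.

Lemma permutes_lines_fun p q g : permutes_lines p g -> permutes_lines q g -> p = q.
Proof.
move=> pg qg; apply/permP => i; apply: line_inj.
exact: same_line_trans (same_line_sym (pg i)) (qg i).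
Qed.

Lemma permutes_lines_exists g h : g *m h = 1%:M ->
  (forall i, exists j, same_line (line i *m g) (line j)) ->
  exists p, permutes_lines p g.
Proof.
move=> gh ex; have /cid[f fP] : exists f : 'I_n -> 'I_n,
    forall i, same_line (line i *m g) (line (f i)).
  by exists (fun i => projT1 (cid (ex i))) => i; case: cid.
have f_inj : injective f.
  move=> i j fij; apply: line_inj.
  have := same_line_trans (fP i) (same_line_sym _); rewrite fij => /(_ _ (fP j)).
  by move/(same_line_mul h); rewrite -!mulmxA gh !mulmx1.
by exists (perm f_inj) => i; rewrite permE.
Qed.

End Lines.

(* Like all entries, the coordinates of the lines in V are doubled. *)
Definition list_line (e : int) n (V : cmat) (i : 'I_n) : 'rV['F_3]_5 :=
  mx (e%:~R : 'F_3) 1 5 [:: nth [::] V i].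

Definition maps_line (e : int) (V M : cmat) i j : bool :=
  is_prod (mod3 e) 1 5 5 [:: nth [::] V i] M [:: nth [::] V j] ||
  is_prod (mod3 e) 1 5 5 [:: nth [::] V i] M [:: map zopp (nth [::] V j)].

Definition wf_lines (V : cmat) := all (fun r => size r == 5%N) V.

Lemma maps_lineP e n V M (i j : 'I_n) : is_sign e -> size V = n -> wf_lines V ->
  reflect (same_line (list_line e V i *m mx (e%:~R : 'F_3) 5 5 M) (list_line e V j))
    (maps_line e V M i j).
Proof.
move=> e1 sV wV; rewrite /maps_line !(is_prodE (sign_F3 e1) _ _ _ _ _ _ (mod3E e)).
rewrite -/(list_line e V i) -/(list_line e V j).
have -> : mx (e%:~R : 'F_3) 1 5 [:: map zopp (nth [::] V j)] = - list_line e V j.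
  apply/matrixP => k l; rewrite !mxE ord1 /entry /= (nth_map (0, 0)).
    by rewrite /hval zvalN mulrN.
  have /allP/(_ (nth [::] V j)) := wV; rewrite mem_nth ?sV // => /(_ isT)/eqP ->.
  exact: ltn_ord.
apply: (iffP orP) => -[E|E]; [left | right | left | right]; apply/eqP => //; exact/eqP.
Qed.

Lemma list_line_inj e n V : is_sign e -> size V = n -> wf_lines V ->
  all (fun i => all (fun j => maps_line e V c1 i j ==> (i == j)) (iota 0 n)) (iota 0 n) ->
  forall i j : 'I_n, same_line (list_line e V i) (list_line e V j) -> i = j.
Proof.
move=> e1 sV wV /allP all_i i j ij.
have im : (i : nat) \in iota 0 n by rewrite mem_iota ltn_ord.
have jm : (j : nat) \in iota 0 n by rewrite mem_iota ltn_ord.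
apply/val_inj/eqP; apply: implyP (allP (all_i _ im) _ jm) _.
apply/(maps_lineP _ _ _ e1 sV wV).
by rewrite (mx_c1 (sign_F3 e1)) mulmx1.
Qed.

(** * The groups H, K and their intersection *)

Definition lower_rows : cmat :=
  [:: [:: (0, 0); (0, 0); (0, 0); (2, 0); (0, 0)];
      [:: (0, 0); (0, 0); (0, 0); (0, 0); (2, 0)]].
Definition lower (M : cmat) : cmat := build 2 5 (fun i j => entry M (3 + i) j).
Definition block (M : cmat) : cmat := build 2 2 (fun i j => entry M (3 + i) (3 + j)).

(** For W the last two basis rows and B the block of M, this is W M = B W: the row space of W is
    invariant. *)
Definition block_ok (M : cmat) : bool :=
  is_prod exact0 2 5 5 lower_rows M (lower M) &&
  is_prod exact0 2 2 5 (block M) lower_rows (lower M).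

Definition block_trivial (M : cmat) : bool :=
  is_prod (mod3 1) 2 2 5 (block M) lower_rows lower_rows.

(** The diagonals of a cube in the coordinates 1, 4, 5, on which K acts by signed permutations. *)
Definition four_lines : cmat :=
  [:: [:: (2, 0); (0, 0); (0, 0); (2, 0); (2, 0)];
      [:: (2, 0); (0, 0); (0, 0); (2, 0); (-2, 0)];
      [:: (2, 0); (0, 0); (0, 0); (-2, 0); (2, 0)];
      [:: (-2, 0); (0, 0); (0, 0); (2, 0); (2, 0)]].

Definition factor_lists_ok (lH lK lA : seq cmat) : bool :=
  [&& [&& closed_list [:: cb; cc] lH, closed_list [:: ca; cb; cd] lK
        & closed_list [:: ca; cb] lA],
      [&& size lH == 48%N, size lK == 24%N & size lA == 8%N],
      all block_ok lH && all (fun M => block_trivial M ==> (M == c1)) lH,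
      all (fun M => all (fun i => maps_line 1 four_lines M i i) (iota 0 4) ==>
        (M == c1)) lK &
      (ca \in lH) && all (fun M => (M \in lK) ==> (M \in lA)) lH].

(* The lists are kept abstract, as tactics might otherwise compute them. *)
Lemma factor_lists : exists lH lK lA,
  [/\ lH = closure 9 [:: cb; cc], lK = closure 4 [:: ca; cb; cd],
      lA = closure 3 [:: ca; cb] & factor_lists_ok lH lK lA].
Proof.
by do 3![eexists]; split; [reflexivity | reflexivity | reflexivity | vm_compute].
Qed.

Lemma compress_mx (F : comNzRingType) m n (W L : 'M[F]_(m, n)) A B :
  W *m W^T = 1%:M -> W *m A = L -> B *m W = L -> W *m A *m W^T = B.
Proof. by move=> W1 -> <-; rewrite -mulmxA W1 mulmx1. Qed.

Lemma mx_lower_rows (A : comNzRingType) (u : A) : 2 * u ^+ 2 = -1 ->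
  mx u 2 5 lower_rows *m (mx u 2 5 lower_rows)^T = 1%:M.
Proof.
move=> u2; have WE i j : mx u 2 5 lower_rows i j = (j == rshift 3 i)%:R.
  rewrite !mxE; apply: (half_inj u2).
  have : all (fun i => all (fun j =>
      entry lower_rows i j == ((2 * (j == 3 + i)%N)%N : int, 0)) (iota 0 5)) (iota 0 2).
    by [].
  move=> /allP/(_ i); rewrite mem_iota ltn_ord => /(_ isT).
  move=> /allP/(_ j); rewrite mem_iota ltn_ord => /(_ isT)/eqP ->.
  by rewrite hval2 // /zval /= mul0r mulr0 subr0 -pmulrn natrM.
apply/matrixP => i k; rewrite !mxE (bigD1 (rshift 3 i)) //= [(_)^T _ _]mxE !WE eqxx mul1r.
rewrite big1 ?addr0 => [|j ji]; last by rewrite WE (negbTE ji) mul0r.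
by rewrite -val_eqE /= eqn_add2l.
Qed.

Section FactorGroups.
Variable R : realType.
Local Notation Zt := (Zsqrtm2V R).
Local Notation tau := (gen_Zt R).
Local Notation mxt := (@mx Zt tau 5 5).
Local Notation gH := [:: gen_b R; gen_c R].
Local Notation gK := [:: gen_a R; gen_b R; gen_d R].
Local Notation gA := [:: gen_a R; gen_b R].

Lemma val_gH : [seq val x | x <- gH] = [seq mxt M | M <- [:: cb; cc]].
Proof. exact: erefl. Qed.

Lemma val_gK : [seq val x | x <- gK] = [seq mxt M | M <- [:: ca; cb; cd]].
Proof. exact: erefl. Qed.

Lemma val_gA : [seq val x | x <- gA] = [seq mxt M | M <- [:: ca; cb]].
Proof. exact: erefl. Qed.

Lemma unitary_gens : [&& is_special_unitary ca, is_special_unitary cb,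
  is_special_unitary cc & is_special_unitary cd].
Proof. by vm_compute. Qed.

Lemma unitary_gH : all is_special_unitary [:: cb; cc].
Proof. by case/and4P: unitary_gens => ? E1 E2 ?; rewrite /all E1 E2. Qed.

Lemma unitary_gK : all is_special_unitary [:: ca; cb; cd].
Proof. by case/and4P: unitary_gens => E1 E2 ? E3; rewrite /all E1 E2 E3. Qed.

Lemma unitary_gA : all is_special_unitary [:: ca; cb].
Proof. by case/and4P: unitary_gens => E1 E2 ? ?; rewrite /all E1 E2. Qed.

(** The lower block is reduced with sqrt(-2) sent to 1. Among the 48 listed matrices only the
    identity has trivial reduced block, and GL(2, 3) has order 48. *)
Lemma iso_H : iso_fin (subgrp (gen gH)) 'GL_2(3).
Proof.
have [l [_ [_ [lE _ _ /and5P[/and3P[cl _ _] /and3P[/eqP sl _ _]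
  /andP[/allP ok /allP triv] _ _]]]]] := factor_lists.
have [xs [u_xs s_xs all_xs]] := enum_elts val_gH unitary_gH cl lE.
have e2 := sign_F3 (isT : is_sign 1).
have [k kE] := redF3_exists R e2.
pose W : 'M['F_3]_(2, 5) := mx (1%:~R : 'F_3) 2 5 lower_rows.
have W1 : W *m W^T = 1%:M := mx_lower_rows e2.
pose red (x : subgrp (gen gH)) : 'M['F_3]_5 := map_mx k (SU_val (subgrp_val x)).
have redM x y : red (x * y)%g = red x *m red y by exact: map_mxM.
have redE x M : SU_val (subgrp_val x) = mxt M -> red x = mx (1%:~R : 'F_3) 5 5 M.
  by move=> xM; rewrite /red xM -kE; exact: map_mx_mx.
have exact_F3 z : exact0 z -> zval (1%:~R : 'F_3) z = 0.
  by move/eqP ->; exact: zval0.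
have imp m n p := @is_prod_imp _ _ e2 exact0 m n p.
pose f x := W *m red x *m W^T.
have fE x : exists2 M, M \in l & [/\ SU_val (subgrp_val x) = mxt M,
    W *m red x = f x *m W & f x = mx (1%:~R : 'F_3) 2 2 (block M)].
  have [M Ml xM] := gen_enum val_gH unitary_gH cl (valP x).
  exists M; first exact: Ml.
  have /andP[/(imp _ _ _ _ _ _ exact_F3) WM /(imp _ _ _ _ _ _ exact_F3) BW] := ok _ Ml.
  have fB : f x = mx (1%:~R : 'F_3) 2 2 (block M).
    by rewrite /f (redE _ _ xM); exact: compress_mx W1 WM BW.
  split; [exact: xM | | exact: fB].
  by rewrite fB (redE _ _ xM); exact: etrans WM (esym BW).
(* The invariance [W *m red x = f x *m W] makes the compression multiplicative. *)
have fM x y : f (x * y)%g = f x *m f y.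
  have [M _ [_ Wx _]] := fE x.
  by rewrite {1}/f redM mulmxA Wx -mulmxA -mulmxA [W *m _]mulmxA.
have f1 : f 1%g = 1%:M.
  have red1 : red 1%g = 1%:M by exact: map_mx1.
  by rewrite /f red1 mulmx1; exact: W1.
have [F FE] := hom_to_GL f1 fM.
have F_inj : injective F.
  apply: hom_inj => x Fx; have fx : f x = 1%:M by rewrite -FE Fx.
  have [M Ml [xM _ fB]] := fE x.
  have M1 : M = c1.
    apply/eqP; apply: (implyP (triv _ Ml)).
    rewrite /block_trivial (is_prodE e2 _ _ _ _ _ _ (mod3E 1)) -fB fx mul1mx.
    exact: eqxx.
  by apply: subgrp_SU_inj; rewrite xM M1; exact: mx_c1 (gen_Zt_sqr R).
apply: (iso_fin_card F_inj u_xs all_xs) => [x|]; first by rewrite inE.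
by rewrite s_xs sl card_GL_2 card_Fp.
Qed.
End FactorGroups.

Section FactorGroupK.
Variable R : realType.
Local Notation Zt := (Zsqrtm2V R).
Local Notation tau := (gen_Zt R).
Local Notation mxt := (@mx Zt tau 5 5).
Local Notation gH := [:: gen_b R; gen_c R].
Local Notation gK := [:: gen_a R; gen_b R; gen_d R].
Local Notation gA := [:: gen_a R; gen_b R].
Local Notation SU := (SU5 R).

Lemma four_lines_ok : wf_lines four_lines &&
  all (fun i => all (fun j => maps_line 1 four_lines c1 i j ==> (i == j))
    (iota 0 4)) (iota 0 4) &&
  all (fun M => all (fun i => has (maps_line 1 four_lines M i) (iota 0 4)) (iota 0 4))
    [:: ca; cb; cd].
Proof. by vm_compute. Qed.

(** Modulo 3 the generators permute the four diagonals, and of the listed matrices only the identity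
    fixes all four. *)
Lemma hom_K_exists : exists2 F : {multiplicative subgrp (gen gK) -> 'S_4},
  injective F & forall x y, (forall i, F x i = F y i) -> x = y.
Proof.
have [_ [l [_ [_ lE _ /and5P[/and3P[_ cl _] _ _ /allP triv _]]]]] := factor_lists.
have /andP[/andP[wf dist] /allP maps] := four_lines_ok.
have e1 : is_sign 1 := isT.
have e2 := sign_F3 e1.
have [k kE] := redF3_exists R e2.
pose line := @list_line 1 4 four_lines.
have line_inj := list_line_inj e1 (erefl : size four_lines = 4%N) wf dist.
pose red (x : SU) : 'M['F_3]_5 := map_mx k (SU_val x).
have redM x y : red (x * y)%g = red x *m red y by exact: map_mxM.
have red1 : red 1%g = 1%:M by exact: map_mx1.
have redE x M : SU_val x = mxt M -> red x = mx (1%:~R : 'F_3) 5 5 M.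
  by move=> xM; rewrite /red xM -kE; exact: map_mx_mx.
have redV x : red x *m red x^-1%g = 1%:M by rewrite -redM mulgV; exact: red1.
pose S x := exists p, permutes_lines line p (red x).
have S1 : S 1%g by exists 1%g; rewrite red1; exact: permutes_lines1.
have SM x y : S x -> S y -> S (x * y)%g.
  by case=> p px [q qy]; exists (p * q)%g; rewrite redM; exact: permutes_linesM.
have Sg x : x \in gK -> S x /\ S x^-1%g.
  move=> /(gens_cgens (val_gK R))[M Mg xM].
  have [p px] : S x.
    apply: (permutes_lines_exists line_inj (redV x)) => i.
    have im : (i : nat) \in iota 0 4 by rewrite mem_iota ltn_ord.
    have /hasP[j] := allP (maps _ Mg) _ im; rewrite mem_iota => /= j4 ij.
    exists (Ordinal j4); rewrite (redE _ _ xM).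
    by apply/(maps_lineP _ _ _ e1 erefl wf).
  split; first by exists p.
  by exists p^-1%g; exact: permutes_linesV (redV x) px.
have SK := gen_subset_prop S1 SM Sg.
have /cid[f fP] : exists f : subgrp (gen gK) -> 'S_4,
    forall x, permutes_lines line (f x) (red (subgrp_val x)).
  exists (fun x => projT1 (cid (SK _ (valP x)))) => x.
  by case: cid.
have fM : {morph f : x y / (x * y)%g}.
  move=> x y; apply: (permutes_lines_fun line_inj (fP _)).
  by rewrite redM; exact: permutes_linesM.
pose F : {multiplicative subgrp (gen gK) -> 'S_4} :=
  HB.pack_for {multiplicative subgrp (gen gK) -> 'S_4} f
    (isMultiplicative.Build _ _ f fM).
have F_inj : injective F.
  apply: hom_inj => x fx; have [M Ml xM] := gen_enum (val_gK R) unitary_gK cl (valP x).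
  have M1 : M = c1.
    apply/eqP; apply: (implyP (triv _ Ml)); apply/allP => i.
    rewrite mem_iota => /= i4; have := fP x (Ordinal i4).
    rewrite -[f x]/(F x) fx perm1 (redE _ _ xM).
    by move/(maps_lineP _ _ _ e1 erefl wf).
  by apply: subgrp_SU_inj; rewrite xM M1; exact: mx_c1 (gen_Zt_sqr R).
by exists F; [exact: F_inj | move=> x y /permP/F_inj].
Qed.

Lemma iso_K : iso_fin (subgrp (gen gK)) [set: 'S_4]%G.
Proof.
have [lH [l [lA [_ lE _ lists_ok]]]] := factor_lists.
case/and5P: lists_ok => /and3P[_ cl _] /and3P[_ /eqP sl _] _ _ _.
have [F F_inj _] := hom_K_exists.
have [xs [u_xs s_xs all_xs]] := enum_elts (val_gK R) unitary_gK cl lE.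
apply: (iso_fin_card F_inj u_xs all_xs) => [x|]; first by rewrite inE.
by rewrite s_xs sl cardsT card_Sn.
Qed.

(** A common element has the same code in both lists, which the finite check finds in the list of
    <a, b>; conversely, [ca] occurs in the list of H. *)
Lemma cap_HK : cap (gen gH) (gen gK) =i gen gA.
Proof.
have [lH [lK [lA [lHE lKE lAE]]]] := factor_lists.
case/and5P=> /and3P[clH clK clA] _ _ _ /andP[aH /allP capA] x.
apply/idP/idP.
  case/andP=> xH xK.
  have [M MH xM] := gen_enum (val_gH R) unitary_gH clH xH.
  have [N NK xN] := gen_enum (val_gK R) unitary_gK clK xK.
  have MN : M = N.
    case/and4P: clH => _ _ /allP wH _; case/and4P: clK => _ _ /allP wK _.
    exact: mxt_inj (wH _ MH) (wK _ NK) (etrans (esym xM) xN).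
  have MA : M \in lA by apply: (implyP (capA _ MH)); rewrite MN.
  have [y yA yM] := enum_gen (val_gA R) lAE MA.
  have -> : x = y by apply: val_inj; exact: etrans xM (esym yM).
  exact: yA.
move=> xA; have [aH' aK] : gen_a R \in gen gH /\ gen_a R \in gen gK.
  split; last by apply: gens_in_gen; rewrite inE eqxx.
  have [y yH yM] := enum_gen (val_gH R) lHE aH.
  by have -> : gen_a R = y by apply: val_inj; exact: esym yM.
move: xA => /genP/(_ (cap (gen gH) (gen gK))) xA.
apply: xA; first by split; [exact: cap1 | exact: gpredF].
move=> y; rewrite !inE => /orP[]/eqP ->; apply/andP; split.
- exact: aH'.
- exact: aK.
- by apply: gens_in_gen; rewrite inE eqxx.
- by apply: gens_in_gen; rewrite !inE eqxx orbT.
Qed.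
End FactorGroupK.

Lemma iso_fin_eq (X : groupType) (P Q : groupClosed X) (gT : finGroupType)
    (S : {group gT}) : P =i Q -> iso_fin (subgrp P) S -> iso_fin (subgrp Q) S.
Proof.
move=> PQ [f [f_inj fS]].
have QP (x : subgrp Q) : subgrp_val x \in P by rewrite PQ; exact: valP x.
pose j (x : subgrp Q) : subgrp P := Subgrp (QP x).
have jM : {morph (fun x => f (j x)) : x y / (x * y)%g}.
  by move=> x y; rewrite -gmulfM; congr (f _); exact: val_inj.
pose h : {multiplicative subgrp Q -> gT} :=
  HB.pack_for {multiplicative subgrp Q -> gT} (fun x => f (j x))
    (isMultiplicative.Build _ _ (fun x => f (j x)) jM).
exists h; split.
  by move=> x y /f_inj/(congr1 val) /= xy; exact: val_inj.
move=> s; split; last by case=> x <-; apply/fS; exists (j x).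
move=> /fS[x <-]; have xQ : subgrp_val x \in Q by rewrite -PQ; exact: valP x.
exists (Subgrp xQ); rewrite /h /=; congr (f _); exact: val_inj.
Qed.

Section Dihedral.
Variable R : realType.
Local Notation Zt := (Zsqrtm2V R).
Local Notation tau := (gen_Zt R).
Local Notation mxt := (@mx Zt tau 5 5).
Local Notation a := (gen_a R).
Local Notation b := (gen_b R).
Local Notation gH := [:: gen_b R; gen_c R].
Local Notation gK := [:: gen_a R; gen_b R; gen_d R].
Local Notation gA := [:: gen_a R; gen_b R].
Local Notation SU := (SU5 R).

Lemma dihedral_products : let a2 := cmul ca ca in let ab := cmul ca cb in
  [&& exact_prod ca ca a2, exact_prod a2 a2 c1, exact_prod cb cb c1,
      exact_prod ca cb ab & exact_prod ab ab c1].
Proof. by vm_compute. Qed.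

Lemma SU_prod (x y z : SU) M N L : SU_val x = mxt M -> SU_val y = mxt N ->
  SU_val z = mxt L -> exact_prod M N L -> (x * y = z)%g.
Proof.
move=> xM yN zL; rewrite (exact_prodE R) => /eqP E; apply: val_inj.
by rewrite -[LHS]/(SU_val x *m SU_val y) -[RHS]/(SU_val z) xM yN E zL.
Qed.

Lemma dihedral_relations :
  [/\ (a * a * (a * a) = 1)%g, (b * b = 1)%g & (a * b * (a * b) = 1)%g].
Proof.
have v1 : SU_val (1%g : SU) = mxt c1 by exact: esym (mx_c1 (gen_Zt_sqr R)).
have va : SU_val a = mxt ca by exact: erefl.
have vb : SU_val b = mxt cb by exact: erefl.
have /and5P[Ea2 Ea4 Eb2 Eab Eabab] := dihedral_products.
have prod_val (x y : SU) M N L : SU_val x = mxt M -> SU_val y = mxt N ->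
    exact_prod M N L -> SU_val (x * y)%g = mxt L.
  move=> xM yN; rewrite (exact_prodE R) => /eqP E.
  by rewrite -[LHS]/(SU_val x *m SU_val y) xM yN.
split.
- exact: SU_prod (prod_val _ _ _ _ _ va va Ea2) (prod_val _ _ _ _ _ va va Ea2) v1 Ea4.
- exact: (SU_prod vb vb v1 Eb2).
- exact: SU_prod (prod_val _ _ _ _ _ va vb Eab) (prod_val _ _ _ _ _ va vb Eab) v1 Eabab.
Qed.

Lemma gA_gK x : x \in gen gA -> x \in gen gK.
Proof.
move=> /genP/(_ (gen gK)); apply; first by split; [exact: gen1 | exact: gpredF].
move=> y yA; apply: gens_in_gen; move: yA.
by rewrite !inE => /orP[] ->; rewrite ?orbT.
Qed.

(** The relations are carried along K to the finite group S_4, where the presentation of the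
    dihedral group applies. *)
Lemma iso_A : iso_fin (subgrp (gen gA)) 'D_(8%N)%G.
Proof.
have [F F_inj _] := hom_K_exists R.
have [lH [lK [l [_ _ lE lists_ok]]]] := factor_lists.
case/and5P: lists_ok => /and3P[_ _ cl] /and3P[_ _ /eqP sl] _ _ _.
have [xs [u_xs s_xs all_xs]] := enum_elts (val_gA R) unitary_gA cl lE.
pose j (x : subgrp (gen gA)) : subgrp (gen gK) := Subgrp (gA_gK (valP x)).
have jM x y : j (x * y)%g = (j x * j y)%g by apply: val_inj.
pose f x := F (j x).
have fM : {morph f : x y / (x * y)%g} by move=> x y; rewrite /f jM gmulfM.
pose h : {multiplicative subgrp (gen gA) -> 'S_4} :=
  HB.pack_for {multiplicative subgrp (gen gA) -> 'S_4} f
    (isMultiplicative.Build _ _ f fM).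
have h_inj : injective h.
  by move=> x y /F_inj/(congr1 (@subgrp_val _ _)) xy; exact: val_inj.
have [D hD] := hom_image_group h.
have D8 : #|D| = 8%N by rewrite (card_hom_image h_inj u_xs all_xs hD) s_xs.
have aA : a \in gen gA by apply: gens_in_gen; rewrite inE eqxx.
have bA : b \in gen gA by apply: gens_in_gen; rewrite !inE eqxx orbT.
pose a' : subgrp (gen gA) := Subgrp aA.
pose b' : subgrp (gen gA) := Subgrp bA.
have h1 : h 1%g = 1%g := mulg_hom1 h.
have [ra rb rab] := dihedral_relations.
have x4 : (h a' ^+ 4 = 1)%g.
  rewrite (_ : (h a' ^+ 4)%g = h (a' * a' * (a' * a'))%g).
    by rewrite -h1; congr (h _); apply: val_inj.
  by rewrite !gmulfM -!expg2 -expgM.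
have y2 : (h b' ^+ 2 = 1)%g.
  by rewrite expg2 -gmulfM -h1; congr (h _); apply: val_inj.
have xy2 : (h a' * h b' * (h a' * h b') = 1)%g.
  by rewrite -!gmulfM -h1; congr (h _); apply: val_inj.
have xy : (h a' ^ h b' = (h a')^-1)%g.
  apply/eqP; rewrite eq_sym eq_invg_mul /conjg.
  have -> : (h b')^-1%g = h b' by apply/eqP; rewrite eq_invg_mul -expg2 y2.
  by rewrite -xy2 !mulgA.
have isoD : iso_fin (subgrp (gen gA)) D by exists h; split; [exact: h_inj | exact: hD].
suff Dxy : D = (<[h a']> <*> <[h b']>)%g :> {set _}.
  exact: iso_fin_isog isoD (dihedral8_isog D8 Dxy x4 y2 xy).
apply/eqP; rewrite eqEsubset join_subG !cycle_subG.
apply/and3P; split; [ | by apply: (proj2 (hD _)); exists a'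
  | by apply: (proj2 (hD _)); exists b'].
apply/fintype.subsetP => s /hD[x <-].
pose S (y : SU) := exists2 z : subgrp (gen gA), subgrp_val z = y &
  h z \in (<[h a']> <*> <[h b']>)%g.
have S1 : S 1%g by exists 1%g; rewrite ?h1 ?group1.
have SM y z : S y -> S z -> S (y * z)%g.
  case=> u <- hu [v <- hv]; exists (u * v)%g; first by [].
  by rewrite gmulfM groupM.
have SV y : S y -> S y^-1%g.
  case=> u <- hu; exists u^-1%g; first by [].
  by rewrite mulg_homV groupV.
have Sg y : y \in gA -> S y /\ S y^-1%g.
  move=> yg; suff Sy : S y by split; [exact: Sy | exact: SV].
  move: yg; rewrite !inE => /orP[]/eqP ->.
    exists a'; first exact: erefl.
    by apply: (fintype.subsetP (joing_subl _ _)); exact: cycle_id.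
  exists b'; first exact: erefl.
  by apply: (fintype.subsetP (joing_subr _ _)); exact: cycle_id.
have [z zx hz] := gen_subset_prop S1 SM Sg (valP x).
by have -> : x = z by apply: val_inj; exact: esym zx.
Qed.

Lemma iso_cap : iso_fin (subgrp (cap (gen gH) (gen gK))) 'D_(8%N)%G.
Proof. by apply: iso_fin_eq iso_A => x; rewrite cap_HK. Qed.
End Dihedral.

(** * Absolute irreducibility *)

Section EnvelopingAlgebra.

(** Noncommutative polynomials as syntax, so that one term can be evaluated on matrices and on
    lists. *)
Inductive alg :=
  Gen of nat | Add of alg & alg | Opp of alg | Mul of alg & alg.

Fixpoint alg_mx (F : comNzRingType) n (gens : nat -> 'M[F]_n) t : 'M[F]_n :=
  match t with
  | Gen i => gens i
  | Add t1 t2 => alg_mx gens t1 + alg_mx gens t2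
  | Opp t1 => - alg_mx gens t1
  | Mul t1 t2 => alg_mx gens t1 *m alg_mx gens t2
  end.

Definition mod3z (z : zpair) : zpair := ((z.1 %% 3)%Z, (z.2 %% 3)%Z).

(* Modulo 3, halving is the same as changing sign. *)
Fixpoint alg_list (gens : seq cmat) t : cmat :=
  match t with
  | Gen i => nth [::] gens i
  | Add t1 t2 => let M := alg_list gens t1 in let N := alg_list gens t2 in
      build 5 5 (fun i j => mod3z (zadd (entry M i j) (entry N i j)))
  | Opp t1 => let M := alg_list gens t1 in
      build 5 5 (fun i j => zopp (entry M i j))
  | Mul t1 t2 => let M := alg_list gens t1 in let N := alg_list gens t2 in
      build 5 5 (fun i j => mod3z (zopp (prod_entry 5 M N i j)))
  end.

Lemma intr_mod3 (m : int) : ((m %% 3)%Z)%:~R = m%:~R :> 'F_3.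
Proof.
apply/eqP; rewrite -subr_eq0 -rmorphB intr_F3_eq0.
by rewrite {2}(divz_eq m 3) opprD addrCA subrr addr0 -mulNr dvdz_mull.
Qed.

Lemma zval_mod3 (u : 'F_3) z : zval u (mod3z z) = zval u z.
Proof. by rewrite /zval !intr_mod3. Qed.

Lemma sign_F3_sqr e : is_sign e -> (e%:~R : 'F_3) ^+ 2 = 1.
Proof. by case/orP=> /eqP ->; apply/eqP. Qed.

Lemma alg_listE e gens t : is_sign e ->
  mx (e%:~R : 'F_3) 5 5 (alg_list gens t) =
  alg_mx (fun i => mx (e%:~R : 'F_3) 5 5 (nth [::] gens i)) t.
Proof.
move=> e1; have hE z : hval (e%:~R : 'F_3) z = - zval e%:~R z.
  by rewrite /hval sign_F3_sqr // mulN1r.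
elim: t => [i|t1 IH1 t2 IH2|t1 IH1|t1 IH1 t2 IH2] //=;
  rewrite -IH1 -?IH2; apply/matrixP => i j.
- by rewrite !mxE entry_build !hE zval_mod3 zvalD opprD.
- by rewrite !mxE entry_build !hE zvalN.
rewrite !mxE entry_build !hE zval_mod3 zvalN opprK zval_sum.
apply: eq_bigr => k _; rewrite !mxE zvalM; last exact: sign_F3.
by rewrite !hE mulrNN.
Qed.

Variables (e : int).

Definition one := Gen 0.
Definition ga := Gen 1.
Definition gb := Gen 2.
Definition gc := Gen 3.
Definition gd := Gen 4.
Definition sub t1 t2 := Add t1 (Opp t2).
(** The entries 1/sqrt(-2) of c change sign with [e]; this correction lets the same terms serve both
    reductions. *)
Definition signed t := if e == 1 then t else Opp t.

(* The character sum over the Klein group of sign changes of the first, fourth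
   and fifth coordinates, which K contains; it is 4 = 1 times a matrix unit. *)
Definition unit00 := sub (sub (Add one (Mul ga ga))
  (Mul ga (Mul ga (Mul ga (Mul gb ga))))) gb.

(* [row_mover j] maps the first row vector of the standard basis to the j-th
   one, and [col_mover i] does the same for columns. *)
Definition row_mover j := nth one [:: one;
  Add (Opp gc) (Add one (Mul gc ga)); signed (Add gc (Mul gc ga));
  gd; Mul gd gd] j.
Definition col_mover i := nth one [:: one;
  sub (sub gc one) (Mul ga gc); Opp (signed (Add gc (Mul ga gc)));
  Mul gd gd; gd] i.
Definition unit_alg i j := Mul (col_mover i) (Mul unit00 (row_mover j)).

Definition is_unit_list i j (M : cmat) := all (fun k => all (fun l =>
  mod3 e (zadd (entry M k l) (zopp ((2 * ((k == i) && (l == j)))%N : int, 0))))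
  (iota 0 5)) (iota 0 5).

Definition gens5 := [:: c1; ca; cb; cc; cd].

Definition unit_alg_ok := all (fun i => all (fun j =>
  is_unit_list i j (alg_list gens5 (unit_alg i j))) (iota 0 5)) (iota 0 5).

Lemma is_unit_listP (i j : 'I_5) M : is_sign e -> is_unit_list i j M ->
  mx (e%:~R : 'F_3) 5 5 M = delta_mx i j.
Proof.
move=> e1 /allP iM; apply/matrixP => k l; rewrite !mxE.
have km : (k : nat) \in iota 0 5 by rewrite mem_iota ltn_ord.
have lm : (l : nat) \in iota 0 5 by rewrite mem_iota ltn_ord.
have := allP (iM _ km) _ lm.
rewrite mod3E zvalD zvalN subr_eq0 => /eqP E.
apply: (half_inj (sign_F3 e1)); rewrite hval2 ?E; last exact: sign_F3.
by rewrite /zval /= mul0r mulr0 subr0 -pmulrn natrM.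
Qed.

End EnvelopingAlgebra.

Lemma unit_algs_ok : unit_alg_ok 1 && unit_alg_ok (-1).
Proof. by vm_compute. Qed.

(** All 25 matrix units are polynomials in the reduced generators, so the enveloping algebra is the
    full matrix algebra. *)
Lemma row_full_envelope e (gT : finGroupType) (G : {group gT})
    (rG : mx_representation 'F_3 G 5) : is_sign e ->
  (forall M, M \in [:: ca; cb; cc; cd] ->
     exists2 s, s \in G & rG s = mx (e%:~R : 'F_3) 5 5 M) ->
  mx_absolutely_irreducible rG.
Proof.
move=> e1 rGM; rewrite /mx_absolutely_irreducible /=.
pose E := enveloping_algebra_mx rG.
have genE i : (mx (e%:~R : 'F_3) 5 5 (nth [::] gens5 i) \in E)%MS.
  have EM M : M \in [:: ca; cb; cc; cd] -> (mx (e%:~R : 'F_3) 5 5 M \in E)%MS.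
    by case/rGM=> s sG <-; exact: envelop_mx_id.
  case: i => [|i]; first by rewrite (mx_c1 (sign_F3 e1)); exact: envelop_mx1.
  case: (ltnP i 4) => i4; first exact/EM/(mem_nth [::] (s := [:: ca; cb; cc; cd])).
  rewrite nth_default; last exact: i4.
  (* Past the last generator, the default empty list gives the zero matrix. *)
  have -> : mx (e%:~R : 'F_3) 5 5 [::] = 0.
    by apply/matrixP => k l; rewrite !mxE /entry !nth_nil /hval zval0 mulr0.
  by rewrite linear0 sub0mx.
have algE t : (alg_mx (fun i => mx (e%:~R : 'F_3) 5 5 (nth [::] gens5 i)) t \in E)%MS.
  elim: t => [i|t1 E1 t2 E2|t1 E1|t1 E1 t2 E2] /=; first exact: genE.
  - by rewrite linearD; exact: addmx_sub.
  - by rewrite linearN /= eqmx_opp.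
  - exact: envelop_mxM.
have deltaE (i j : 'I_5) : (delta_mx i j \in E)%MS.
  have ok : unit_alg_ok e.
    by case/andP: unit_algs_ok; case/orP: e1 => /eqP ->.
  have im : (i : nat) \in iota 0 5 by rewrite mem_iota ltn_ord.
  have jm : (j : nat) \in iota 0 5 by rewrite mem_iota ltn_ord.
  have := allP (allP ok _ im) _ jm => /(is_unit_listP e1) <-.
  by rewrite (alg_listE _ _ e1).
rewrite -sub1mx; apply/row_subP => i.
rewrite -[row i 1%:M]vec_mxK [vec_mx _]matrix_sum_delta linear_sum summx_sub // => k _.
rewrite linear_sum summx_sub // => l _.
by rewrite linearZ; apply: scalemx_sub; exact: deltaE.
Qed.

(** * The eleven lines permuted by M11 *)

(** Permutations are transcribed to functions on natural numbers, which can be evaluated. *)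
Definition swap (x y n : nat) : nat :=
  if n == x then y else if n == y then x else n.
Definition cycle_fun x s n : nat := foldl (fun m y => swap x y m) n s.

Lemma cyc11E x s (i : 'I_11) : (x < 11)%N -> all (fun y => y < 11)%N s ->
  val (cyc11 x s i) = cycle_fun x s i.
Proof.
move=> x11; rewrite /cyc11 /cycle_fun; elim: s i => [|y s IH] i /=.
  by rewrite big_nil perm1.
case/andP=> y11 s11; rewrite big_cons permM IH //; congr foldl.
rewrite /swap; case: tpermP => [->|->|/eqP + /eqP].
- by rewrite !inordK // eqxx.
- by rewrite !inordK // eqxx; case: eqP => [->|].
rewrite -!val_eqE /= !inordK // => /negbTE -> /negbTE ->.
by [].
Qed.

Definition letter11 (l : bool) : 'S_11 :=
  if l then (cyc11 2 [:: 6; 10; 7]%N * cyc11 3 [:: 9; 4; 5]%N)%g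
  else cyc11 0 (iota 1 10).
Definition letter_fun (l : bool) (n : nat) : nat :=
  if l then cycle_fun 3 [:: 9; 4; 5]%N (cycle_fun 2 [:: 6; 10; 7]%N n)
  else cycle_fun 0 (iota 1 10) n.

Definition word11 (w : seq bool) : 'S_11 := (\prod_(l <- w) letter11 l)%g.
Definition word_fun (w : seq bool) (n : nat) : nat :=
  foldl (fun m l => letter_fun l m) n w.

Lemma word11E w (i : 'I_11) : val (word11 w i) = word_fun w i.
Proof.
rewrite /word11 /word_fun; elim: w i => [|l w IH] i /=.
  by rewrite big_nil perm1.
rewrite big_cons permM IH; congr foldl.
by case: l; rewrite /= ?permM !cyc11E.
Qed.

Lemma word11_cat v w : word11 (v ++ w) = (word11 v * word11 w)%g.
Proof. by rewrite /word11 big_cat. Qed.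

Lemma letter11_M11 l : letter11 l \in M11.
Proof. by apply: mem_gen; case: l; rewrite !inE eqxx ?orbT. Qed.

Lemma word11_M11 w : word11 w \in M11.
Proof. by apply: group_prod => l _; exact: letter11_M11. Qed.

(** [false] is the 11-cycle and [true] the other generator of M11; words act from left to right. *)
Definition word_a := [:: false; false; true; true; false; false; true; false;
  false; true; false; false].
Definition word_b := [:: true; true].
Definition word_c := [:: false; false; true; false; false; false; false; true;
  true; true; false; true; true; false].
Definition word_d := [:: true; false; true; true; false; false; true; false;
  false].

Definition eleven_lines : cmat := map (map (fun m : int => (2 * m, 0 : int)))
  [:: [:: 0; 0; 1; 0; 0]; [:: 0; 1; -1; 1; 0]; [:: 1; 0; 1; 1; -1];
      [:: 0; 1; 1; 0; 1]; [:: 0; 1; 1; 0; -1]; [:: 1; 0; -1; 1; 1];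
      [:: 1; -1; 0; 0; 0]; [:: 1; 1; 0; 0; 0]; [:: 0; 1; -1; -1; 0];
      [:: 1; 0; 1; -1; 1]; [:: 1; 0; -1; -1; -1]].

Definition word_acts w M :=
  all (fun i => maps_line 1 eleven_lines M i (word_fun w i)) (iota 0 11).

Lemma generators_act : [&& word_acts word_a ca, word_acts word_b cb,
  word_acts word_c cc & word_acts word_d cd].
Proof. by vm_compute. Qed.

Lemma eleven_lines_distinct : all (fun i => all (fun j =>
  maps_line 1 eleven_lines c1 i j ==> (i == j)) (iota 0 11)) (iota 0 11).
Proof. by vm_compute. Qed.

(** The generators of M11 are recovered from the permutations of a, b, c, d, so these generate all
    of M11. *)
Lemma letter11_words :
  letter11 false = word11 (word_a ++ word_c ++ word_d ++ word_a ++ word_c) /\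
  letter11 true = word11 (word_a ++ word_d ++ word_c ++ word_b ++ word_c ++
    word_b ++ word_d).
Proof.
have eqw v w : all (fun n => word_fun v n == word_fun w n) (iota 0 11) ->
    word11 v = word11 w.
  move=> /allP E; apply/permP => i; apply: val_inj; rewrite !word11E; apply/eqP.
  by apply: E; rewrite mem_iota ltn_ord.
have lw l : letter11 l = word11 [:: l] by rewrite /word11 big_seq1.
by split; rewrite lw; apply: eqw; vm_compute.
Qed.

(* The first five lines span, and the seventh one combines them with nonzero
   coefficients; hence a matrix fixing all lines is scalar. *)
Definition frame_inv : cmat := map (map (fun m : int => (2 * m, 0 : int)))
  [:: [:: 0; 2; 1; 1; 0]; [:: 2; 0; 0; 2; 2]; [:: 1; 0; 0; 0; 0];
      [:: 2; 1; 0; 1; 1]; [:: 0; 0; 0; 2; 1]].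
Definition frame_coef : cmat := map (map (fun m : int => (2 * m, 0 : int)))
  [:: [:: 1; 2; 1; 2; 1]].

Lemma frame_ok :
  [&& is_prod (mod3 1) 5 5 5 eleven_lines frame_inv c1,
      is_prod (mod3 1) 1 5 5 frame_coef eleven_lines
        [:: nth [::] eleven_lines 6] &
      all (fun j => ~~ mod3 1 (entry frame_coef 0 j)) (iota 0 5)].
Proof. by vm_compute. Qed.

Notation line11 := (@list_line 1 11 eleven_lines).

Lemma lines11_scalar (h : 'M['F_3]_5) : permutes_lines line11 1%g h -> \det h = 1 ->
  h = 1%:M.
Proof.
move=> h_lines det_h.
have e1 : is_sign 1 := isT.
have e2 := sign_F3 e1.
have isP m n p := is_prodE e2 m n p _ _ _ (mod3E 1).
have /cid[s sE] : exists s : 'I_11 -> 'F_3, forall i, line11 i *m h = s i *: line11 i.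
  have ex i : exists s : 'F_3, line11 i *m h = s *: line11 i.
    case: (h_lines i) => ->; rewrite perm1; first by exists 1; rewrite scale1r.
    by exists (-1); rewrite scaleN1r.
  by exists (fun i => projT1 (cid (ex i))) => i; case: cid.
have /and3P[] := frame_ok; rewrite !isP (mx_c1 e2) => /eqP BC /eqP cB /allP c0.
set B := mx _ 5 5 eleven_lines in BC cB; set C := mx _ 5 5 frame_inv in BC.
set c := mx _ 1 5 frame_coef in cB.
pose lo (i : 'I_5) : 'I_11 := widen_ord (isT : (5 <= 11)%N) i.
have rowB i : row i B = line11 (lo i).
  by apply/rowP => j; rewrite !mxE /entry /= ?ord1.
pose l6 : 'I_11 := inord 6.
have c6 : mx (1%:~R : 'F_3) 1 5 [:: nth [::] eleven_lines 6] = line11 l6.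
  by rewrite /list_line inordK.
rewrite c6 in cB.
have Bh : B *m h = diag_mx (\row_i s (lo i)) *m B.
  apply/row_matrixP => i; rewrite row_mul rowB sE -rowB.
  by apply/rowP => j; rewrite mul_diag_mx !mxE.
have CB : C *m B = 1%:M by exact: mulmx1C.
(* The image of the seventh line is computed both directly and through the basis. *)
have sc : c *m diag_mx (\row_i s (lo i)) = s l6 *: c.
  rewrite -[LHS]mulmx1 -BC mulmxA -[c *m _ *m _]mulmxA -Bh mulmxA cB sE -cB.
  by rewrite -scalemxAl -mulmxA BC mulmx1.
have sl i : s (lo i) = s l6.
  have := congr1 (fun x : 'rV_5 => x 0 i) sc; rewrite mul_mx_diag !mxE mulrC.
  apply: mulIf; have := c0 i; rewrite mem_iota ltn_ord => /(_ isT).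
  by rewrite mod3E /hval; apply: contraNneq => /eqP; rewrite mulf_eq0 oppr_eq0 expf_eq0.
have hs : h = (s l6)%:M.
  rewrite -[h]mul1mx -CB -mulmxA Bh.
  have -> : diag_mx (\row_i s (lo i)) = (s l6)%:M.
    by apply/matrixP => i j; rewrite !mxE sl.
  by rewrite mul_scalar_mx -scalemxAr CB scalemx1.
rewrite hs; congr scalar_mx; move: det_h; rewrite hs det_scalar.
(* The determinant is x^5, which equals 1 in F_3 only for x = 1. *)
by move: (s l6) => x {sc sl hs}; case: x => [[|[|[|?]]]] // lt3 _; exact: val_inj.
Qed.

(* For [e = -1] the lines are permuted in the dual representation. *)
Definition gamma (e : int) (p : 'S_11) (g : 'M['F_3]_5) : Prop :=
  if e == 1 then permutes_lines line11 p g else permutes_lines line11 p^-1%g g^T.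

Lemma line11_inj (i j : 'I_11) : same_line (line11 i) (line11 j) -> i = j.
Proof.
apply: list_line_inj; [exact: isT | exact: erefl | exact: isT |].
exact: eleven_lines_distinct.
Qed.

Section Gamma.
Variable e : int.

Lemma gamma1 : gamma e 1%g 1%:M.
Proof.
rewrite /gamma; case: eqP => _; first exact: permutes_lines1.
by rewrite invg1 trmx1; exact: permutes_lines1.
Qed.

Lemma gammaM p q g h : gamma e p g -> gamma e q h -> gamma e (p * q)%g (g *m h).
Proof.
rewrite /gamma; case: eqP => _; first exact: permutes_linesM.
by move=> pg qh; rewrite invgM trmx_mul; exact: permutes_linesM.
Qed.

Lemma gammaV p g h : g *m h = 1%:M -> gamma e p g -> gamma e p^-1%g h.
Proof.
rewrite /gamma => gh; case: eqP => _; first exact: permutes_linesV.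
by apply: permutes_linesV; rewrite -trmx_mul (mulmx1C gh) trmx1.
Qed.

Lemma gamma_fun p q g : gamma e p g -> gamma e q g -> p = q.
Proof.
rewrite /gamma; case: eqP => _ pg qg; last apply: invg_inj;
  exact: (permutes_lines_fun line11_inj pg qg).
Qed.

(** The quotient g^-1 h, or its transpose, fixes every line and has determinant 1. *)
Lemma gamma_inj p g h : gamma e p g -> gamma e p h -> \det g = 1 -> \det h = 1 ->
  g = h.
Proof.
move=> pg ph dg dh.
have gU : g \in unitmx by rewrite unitmxE dg unitr1.
have gV : g *m invmx g = 1%:M by exact: mulmxV.
have := gammaM (gammaV gV pg) ph; rewrite mulVg => p1.
have d1 : \det (invmx g *m h) = 1 by rewrite det_mulmx det_inv dg dh invr1 mulr1.
have E : invmx g *m h = 1%:M.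
  move: p1; rewrite /gamma; case: eqP => _ p1; first exact: lines11_scalar.
  rewrite invg1 in p1; have := lines11_scalar p1; rewrite det_tr d1 => /(_ erefl).
  by move/(congr1 trmx); rewrite trmxK trmx1.
by rewrite -[h]mul1mx -gV -mulmxA E mulmx1.
Qed.

Lemma gamma_word w M : is_sign e -> is_special_unitary M -> word_acts w M ->
  gamma e (word11 w) (mx (e%:~R : 'F_3) 5 5 M).
Proof.
move=> e1 uM /allP wM.
have M1 : permutes_lines line11 (word11 w) (mx (1%:~R : 'F_3) 5 5 M).
  move=> i; have im : (i : nat) \in iota 0 11 by rewrite mem_iota ltn_ord.
  have := wM _ im; rewrite -word11E.
  by move/(@maps_lineP 1 11 eleven_lines M i _ isT erefl isT).
rewrite /gamma; case/orP: e1 => /eqP -> /=; first exact: M1.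
have MV : mx (1%:~R : 'F_3) 5 5 M *m mx (1%:~R : 'F_3) 5 5 (conj_transpose M) = 1%:M.
  have s1 : is_sign 1 := isT.
  rewrite -(mx_c1 (sign_F3 s1)); case/andP: uM => _.
  apply: (is_prod_imp (sign_F3 s1)) => z /eqP ->; exact: zval0.
(* Conjugation changes the sign of 1/sqrt(-2), so this transpose is the inverse of [M] reduced with
   sign 1. *)
have -> : (mx ((-1)%:~R : 'F_3) 5 5 M)^T = mx (1%:~R : 'F_3) 5 5 (conj_transpose M).
  apply/matrixP => i j; rewrite !mxE /conj_transpose entry_build /hval /zval /= !mulrNz.
  by ring.
exact: permutes_linesV MV M1.
Qed.

End Gamma.

(** * Reduced matrices and elements of M11 *)

Section Mathieu.
Variables (R : realType) (e : int) (k : {rmorphism Zsqrtm2V R -> 'F_3}).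
Hypothesis e1 : is_sign e.
Hypothesis kE : k (gen_Zt R) = e%:~R.
Local Notation SU := (SU5 R).
Local Notation gens := [:: gen_a R; gen_b R; gen_c R; gen_d R].
Local Notation cgens := [:: ca; cb; cc; cd].
Local Notation mxt := (@mx (Zsqrtm2V R) (gen_Zt R) 5 5).

Definition red_mx (x : SU) : 'M['F_3]_5 := map_mx k (SU_val x).
Local Notation red := red_mx.

Lemma red_mxM x y : red (x * y)%g = red x *m red y.
Proof. exact: map_mxM. Qed.

Lemma red_mx1 : red 1%g = 1%:M.
Proof. exact: map_mx1. Qed.

Lemma det_red_mx x : \det (red x) = 1.
Proof. by rewrite /red det_map_mx; have /andP[/eqP -> _] := valP x; exact: rmorph1. Qed.

Lemma red_mxE x M : SU_val x = mxt M -> red x = mx (e%:~R : 'F_3) 5 5 M.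
Proof. by move=> xM; rewrite /red xM -kE; exact: map_mx_mx. Qed.

Lemma gamma_gens : [/\ gamma e (word11 word_a) (red (gen_a R)),
  gamma e (word11 word_b) (red (gen_b R)), gamma e (word11 word_c) (red (gen_c R))
  & gamma e (word11 word_d) (red (gen_d R))].
Proof.
have /and4P[ua ub uc ud] := unitary_gens; have /and4P[wa wb wc wd] := generators_act.
have E (x : SU) M w : SU_val x = mxt M -> is_special_unitary M -> word_acts w M ->
    gamma e (word11 w) (red x).
  by move=> xM uM wM; rewrite (red_mxE xM); exact: gamma_word.
split; [exact: (E (gen_a R) ca word_a erefl ua wa)
  | exact: (E (gen_b R) cb word_b erefl ub wb)
  | exact: (E (gen_c R) cc word_c erefl uc wc)
  | exact: (E (gen_d R) cd word_d erefl ud wd)].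
Qed.

Lemma gamma_onto x : x \in gen gens -> exists2 p, p \in M11 & gamma e p (red x).
Proof.
have [Ga Gb Gc Gd] := gamma_gens.
pose S (x : SU) := exists2 p, p \in M11 & gamma e p (red x).
have S1 : S 1%g by exists 1%g; [exact: group1 | rewrite red_mx1; exact: gamma1].
have SM y z : S y -> S z -> S (y * z)%g.
  case=> p pM py [q qM qz]; exists (p * q)%g; first exact: groupM.
  by rewrite red_mxM; exact: gammaM.
have SV y : S y -> S y^-1%g.
  case=> p pM py; exists p^-1%g; first by rewrite groupV.
  by apply: gammaV py; rewrite -red_mxM mulgV; exact: red_mx1.
have Sw y w : gamma e (word11 w) (red y) -> S y /\ S y^-1%g.
  move=> yw; have Sy : S y by exists (word11 w); [exact: word11_M11 | exact: yw].
  by split; [exact: Sy | exact: SV].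
apply: gen_subset_prop S1 SM _ x => y.
by rewrite !inE => /or4P[]/eqP ->; [exact: Sw Ga | exact: Sw Gb | exact: Sw Gc
  | exact: Sw Gd].
Qed.

Lemma gamma_total p : p \in M11 -> exists2 x, x \in gen gens & gamma e p (red x).
Proof.
have [Ga Gb Gc Gd] := gamma_gens.
pose S p := `[< exists2 x, x \in gen gens & gamma e p (red x) >].
have SM q r : S q -> S r -> S (q * r)%g.
  move=> /asboolP[x xg qx] /asboolP[y yg ry]; apply/asboolP.
  exists (x * y)%g; first by apply: gpredM; [exact: xg | exact: yg].
  by rewrite red_mxM; exact: gammaM.
have S1 : S 1%g.
  by apply/asboolP; exists 1%g; [exact: gen1 | rewrite red_mx1; exact: gamma1].
have Sg x w : x \in gens -> gamma e (word11 w) (red x) -> S (word11 w).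
  by move=> xg wx; apply/asboolP; exists x; [exact: gens_in_gen | exact: wx].
have Sa : S (word11 word_a) := Sg _ _ (@mem_nth _ (gen_a R) gens 0 isT) Ga.
have Sb : S (word11 word_b) := Sg _ _ (@mem_nth _ (gen_a R) gens 1 isT) Gb.
have Sc : S (word11 word_c) := Sg _ _ (@mem_nth _ (gen_a R) gens 2 isT) Gc.
have Sd : S (word11 word_d) := Sg _ _ (@mem_nth _ (gen_a R) gens 3 isT) Gd.
have Sl l : S (letter11 l).
  have [E0 E1] := letter11_words.
  case: l; rewrite ?E0 ?E1 !word11_cat.
    exact: (SM _ _ Sa (SM _ _ Sd (SM _ _ Sc (SM _ _ Sb (SM _ _ Sc (SM _ _ Sb Sd)))))).
  exact: (SM _ _ Sa (SM _ _ Sc (SM _ _ Sd (SM _ _ Sa Sc)))).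
have gS : group_set [set q | S q].
  apply/group_setP; split; first by rewrite inE; exact: S1.
  by move=> q r; rewrite !inE; exact: SM.
suff MS : M11 \subset Group gS.
  by move=> /(fintype.subsetP MS); rewrite inE => /asboolP.
rewrite gen_subG; apply/fintype.subsetP => q; rewrite !inE => /orP[]/eqP ->.
  exact: (Sl false).
exact: (Sl true).
Qed.
End Mathieu.

Section Reduction11.
Variables (R : realType) (e : int) (k : {rmorphism Zsqrtm2V R -> 'F_3}).
Hypothesis e1 : is_sign e.
Hypothesis kE : k (gen_Zt R) = e%:~R.
Local Notation SU := (SU5 R).
Local Notation gens := [:: gen_a R; gen_b R; gen_c R; gen_d R].
Local Notation mxt := (@mx (Zsqrtm2V R) (gen_Zt R) 5 5).
Local Notation red := (red_mx k).
Variables (G : groupType) (rho : {multiplicative G -> SU}).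
Hypothesis rho_onto : forall x, x \in gen gens <-> exists g, rho g = x.

Lemma M11_map_exists : exists phi : {multiplicative G -> 'S_11},
  hom_onto phi M11 /\ forall g, gamma e (phi g) (red (rho g)).
Proof.
have ex g : exists p, p \in M11 /\ gamma e p (red (rho g)).
  have [p pM pg] : exists2 p, p \in M11 & gamma e p (red (rho g)).
    by apply: (gamma_onto e1 kE); apply/rho_onto; exists g.
  by exists p.
have /cid[f fP] : exists f : G -> 'S_11,
    forall g, f g \in M11 /\ gamma e (f g) (red (rho g)).
  by exists (fun g => projT1 (cid (ex g))) => g; case: cid.
have fM : {morph f : x y / (x * y)%g}.
  move=> x y; have [_ fxy] := fP (x * y)%g; have [_ fx] := fP x; have [_ fy] := fP y.
  apply: (gamma_fun fxy); rewrite gmulfM red_mxM; exact: gammaM fx fy.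
exists (HB.pack_for {multiplicative G -> 'S_11} f (isMultiplicative.Build G 'S_11 f fM)).
split=> [p|g]; last by have [] := fP g.
split=> [pM|[g <-]]; last by have [] := fP g.
have [x xg px] := gamma_total e1 kE pM; have [g gx] := (proj1 (rho_onto x)) xg.
exists g; have [_ fg] := fP g; rewrite gx in fg.
exact: gamma_fun fg px.
Qed.

(** Determinant 1 makes the matrix inducing a permutation of M11 unique, so the chosen matrices
    multiply correctly. *)
Lemma M11_repr_exists : exists r : mx_representation 'F_3 M11 5,
  forall p, p \in M11 -> gamma e p (r p) /\ \det (r p) = 1.
Proof.
have ex p : exists g : 'M['F_3]_5, p \in M11 -> gamma e p g /\ \det g = 1.
  case: (boolP (p \in M11)) => [pM|_]; last by exists 0.
  have [x _ px] := gamma_total e1 kE pM.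
  by exists (red x) => _; split; [exact: px | exact: det_red_mx].
have /cid[f fP] : exists f : 'S_11 -> 'M['F_3]_5,
    forall p, p \in M11 -> gamma e p (f p) /\ \det (f p) = 1.
  by exists (fun p => projT1 (cid (ex p))) => p; case: cid.
have fR : mx_repr M11 f.
  split=> [|p q pM qM].
    have [f1 d1] := fP _ (group1 M11).
    exact: gamma_inj f1 (gamma1 e) d1 (det1 _ _).
  have [fpq dpq] := fP _ (groupM pM qM); have [fp dp] := fP _ pM.
  have [fq dq] := fP _ qM.
  apply: gamma_inj fpq (gammaM fp fq) dpq _.
  by rewrite det_mulmx dp dq mulr1.
by exists (MxRepresentation fR).
Qed.

(** Faithfulness holds because a matrix determines its permutation, irreducibility because [r] takes
    the reductions of a, b, c, d as values. *)
Lemma M11_reduction : exists phi : {multiplicative G -> 'S_11},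
  hom_onto phi M11 /\ exists r : mx_representation 'F_3 M11 5,
    [/\ mx_faithful r, mx_absolutely_irreducible r,
        forall s, s \in M11 -> \det (r s) = 1 &
        forall g, map_mx k (val (rho g)) = r (phi g)].
Proof.
have [phi [phiM phiP]] := M11_map_exists; have [r rP] := M11_repr_exists.
have rE x p : p \in M11 -> gamma e p (red x) -> red x = r p.
  move=> pM px; have [rp dp] := rP _ pM.
  exact: gamma_inj px rp (det_red_mx k x) dp.
exists phi; split; first exact: phiM.
exists r; split.
- apply/fintype.subsetP => p /rkerP[pM rp1]; rewrite inE; apply/eqP.
  have [rp _] := rP _ pM; rewrite rp1 in rp.
  exact: gamma_fun rp (gamma1 e).
- apply: (row_full_envelope e1) => M Mg.
  have vg : [seq val x | x <- gens] = [seq mxt M | M <- [:: ca; cb; cc; cd]].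
    exact: erefl.
  have [x xg xM] := cgens_gens_ex vg Mg.
  have [p pM px] := gamma_onto e1 kE (gens_in_gen xg).
  by exists p; [exact: pM | rewrite -(rE _ _ pM px); exact: red_mxE].
- by move=> p /rP[].
move=> g; apply: rE (phiP g); apply/phiM; by exists g.
Qed.
End Reduction11.

Lemma F3_root_sign (x : 'F_3) : 2 * x ^+ 2 = -1 -> exists2 e, is_sign e & x = e%:~R.
Proof.
have -> : 2 = -1 :> 'F_3 by apply/eqP.
rewrite mulN1r => /oppr_inj/eqP; rewrite sqrf_eq1 => /orP[]/eqP ->.
  by exists 1.
by exists (-1); rewrite // mulrNz.
Qed.

(** * The image of the amalgam *)

Section AmalgamImage.
Variables (X : groupType) (a b c d : X).
Local Notation H := (gen [:: b; c]).
Local Notation K := (gen [:: a; b; d]).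
Local Notation gens := [:: a; b; c; d].
Variable rho : {multiplicative amalgam_cap H K -> X}.
Hypothesis rho_l : forall x, rho (amalgam_l x) = val x.
Hypothesis rho_r : forall y, rho (amalgam_r y) = val y.

Lemma gen_sub (l m : seq X) x :
  {subset l <= m} -> x \in gen l -> x \in gen m.
Proof.
move=> lm /genP/(_ (gen m)); apply; first by split; [exact: gen1 | exact: gpredF].
by move=> y /lm; exact: gens_in_gen.
Qed.

Lemma amalgam_image x : x \in gen gens <-> exists g, rho g = x.
Proof.
split=> [xg|[g <-]].
  pose S (y : X) := exists g, rho g = y.
  have S1 : S 1%g by exists 1%g; exact: mulg_hom1.
  have SM y z : S y -> S z -> S (y * z)%g.
    by case=> g <- [h <-]; exists (g * h)%g; exact: gmulfM.
  have SV y : S y -> S y^-1%g.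
    by case=> g <-; exists g^-1%g; exact: mulg_homV.
  have SH y : y \in H -> S y by move=> yH; exists (amalgam_l (Subgrp yH)); exact: rho_l.
  have SK y : y \in K -> S y by move=> yK; exists (amalgam_r (Subgrp yK)); exact: rho_r.
  apply: (gen_subset_prop S1 SM _ xg) => y yg.
  suff Sy : S y by split; [exact: Sy | exact: SV].
  by move: yg; rewrite !inE => /or4P[]/eqP ->; first [apply: SH; apply: gens_in_gen;
    by rewrite !inE eqxx ?orbT | apply: SK; apply: gens_in_gen;
    by rewrite !inE eqxx ?orbT].
elim/amalg_ind: g => [|g s z IH sz]; first by rewrite mulg_hom1; exact: gen1.
rewrite gmulfM; apply: gpredM; first exact: IH.
case: s sz => -[y ->].
  have -> : rho (amalg_inr (@capl _ H K) (@capr _ H K) y) = val y := rho_r y.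
  by apply: gen_sub (valP y) => u; rewrite !inE => /or3P[] ->; rewrite ?orbT.
have -> : rho (amalg_inl (@capl _ H K) (@capr _ H K) y) = val y := rho_l y.
by apply: gen_sub (valP y) => u; rewrite !inE => /orP[] ->; rewrite ?orbT.
Qed.
End AmalgamImage.

Lemma subgrp_valM (X : groupType) (P : groupClosed X) :
  {morph @subgrp_val X P : x y / (x * y)%g}.
Proof. by []. Qed.

Definition subgrp_hom (X : groupType) (P : groupClosed X) :
    {multiplicative subgrp P -> X} :=
  HB.pack_for {multiplicative subgrp P -> X} (@subgrp_val X P)
    (isMultiplicative.Build _ _ (@subgrp_val X P) (@subgrp_valM X P)).

Theorem mainTheorem1 (R : realType) :
  exists a b c d : SU5 R,
    [/\ toC (val a) = mxa R, toC (val b) = mxb R,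
        toC (val c) = mxc R & toC (val d) = mxd R] /\
    let H := gen [:: b; c] in
    let K := gen [:: a; b; d] in
    [/\ iso_fin (subgrp H) 'GL_2(3),
        iso_fin (subgrp K) [set: 'S_4]%G,
        cap H K =i gen [:: a; b] &
        iso_fin (subgrp (cap H K)) 'D_(8%N)%G] /\
    exists rho : {multiplicative amalgam_cap H K -> SU5 R},
      [/\ (forall x, rho (amalgam_l x) = val x) /\
          (forall y, rho (amalgam_r y) = val y),
          (forall rho' : {multiplicative amalgam_cap H K -> SU5 R},
             (forall x, rho' (amalgam_l x) = val x) ->
             (forall y, rho' (amalgam_r y) = val y) -> rho' =1 rho),
          free_group (subgrp (ker_hom rho)) &
          forall I : prime_idealr (Zsqrtm2 R), 3%:R \in I ->
            (exists q : {rmorphism Zsqrtm2V R -> {ideal_quot I}},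
               extends_quotient q) /\
            forall q : {rmorphism Zsqrtm2V R -> {ideal_quot I}},
              extends_quotient q ->
              exists k : {rmorphism {ideal_quot I} -> 'F_3},
                bijective k /\
                exists phi : {multiplicative amalgam_cap H K -> 'S_11},
                  hom_onto phi M11 /\
                  exists r : mx_representation 'F_3 M11 5,
                    [/\ mx_faithful r, mx_absolutely_irreducible r,
                        forall s, s \in M11 -> \det (r s) = 1 &
                        forall g, map_mx (k \o q) (val (rho g)) = r (phi g)]].
Proof.
exists (gen_a R), (gen_b R), (gen_c R), (gen_d R); split.
  split; [exact: toC_gen_a | exact: toC_gen_b | exact: toC_gen_c | exact: toC_gen_d].
move=> H K; split.
  split; [exact: iso_H | exact: iso_K | exact: cap_HK | exact: iso_cap].
pose vH := subgrp_hom H; pose vK := subgrp_hom K.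
have glue l : vH (@capl _ H K l) = vK (@capr _ H K l) by exact: erefl.
have [rho [rho_l rho_r rho_u]] := amalg_universal glue.
exists rho; split.
- by split; [exact: rho_l | exact: rho_r].
- by move=> rho' rho'_l rho'_r; exact: rho_u rho'_l rho'_r.
(* On each factor [rho] is an inclusion, hence injective. *)
- apply: ker_amalg_free => x y.
    by rewrite rho_l rho_l; exact: val_inj.
  by rewrite rho_r rho_r; exact: val_inj.
move=> I I3; split; first exact: extends_quotient_exists.
move=> q _; have [k k_bij] := ideal_quot_F3 I3.
exists k; split; first exact: k_bij.
(* The image of 1/sqrt(-2) in F_3 is a root of 2 x^2 = -1, hence a sign; it decides between the
   representation and its dual. *)
pose K3 : {rmorphism Zsqrtm2V R -> 'F_3} := k \o q.
have K3_2 : 2 * K3 (gen_Zt R) ^+ 2 = -1.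
  have := congr1 K3 (gen_Zt_sqr R).
  by rewrite rmorphM rmorph_nat rmorphXn rmorphN rmorph1.
have [e e1 eE] := F3_root_sign K3_2.
apply: (M11_reduction e1 eE) => x.
exact: amalgam_image rho_l rho_r x.
Qed.
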